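(* Let $D\subseteq\mathbb{C}$ be a domain and let $f$, $g$, $\alpha$ be meromorphic functions on $D$ such that $\alpha$ is not identically $0$ and not identically $\infty$. Suppose that on $D$ the functions $f$ and $g$ share the function $\alpha$ CM in the sense of value. Then $\frac{f}{\alpha}$ and $\frac{g}{\alpha}$ share the value $1$ CM on $D$, i.e. for every $z_0\in D$ and every $m\ge 1$, $\frac{f}{\alpha}-1$ has a zero of order $m$ at $z_0$ if and only if $\frac{g}{\alpha}-1$ has a zero of order $m$ at $z_0$.
   Context: Sharing CM in the sense of value: $f$ and $g$ share $\alpha$ CM in the sense of value on $D$ if for every $z_0\in D$: (i) if $\alpha(z_0)\neq\infty$, then for every $m\ge1$, $f-\alpha$ has a zero of order $m$ at $z_0$ if and only if $g-\alpha$ has a zero of order $m$ at $z_0$; (ii) if $\alpha(z_0)=\infty$, then for every $m\ge1$, $\frac{1}{f}-\frac{1}{\alpha}$ has a zero of order $m$ at $z_0$ if and only if $\frac{1}{g}-\frac{1}{\alpha}$ has a zero of order $m$ at $z_0$. *)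

(* Defs.v *)
From HB Require Import structures.
From mathcomp Require Import all_boot all_order all_algebra.
From mathcomp Require Import all_classical all_reals all_analysis.
From mathcomp Require Import complex.
Set Implicit Arguments. Unset Strict Implicit. Unset Printing Implicit Defensive.
Import Order.TTheory GRing.Theory Num.Theory.
Import numFieldNormedType.Exports.
Local Open Scope classical_set_scope.
Local Open Scope ring_scope.
Local Open Scope complex_scope.

(* The complex plane over R, seen through its numClosedFieldType structure so
   that MathComp-Analysis's topology / normed-module instances (modulus norm)
   apply. *)
Notation Cx R := (Num.ClosedField.sort (complex R)).

Section Mero.
Variable R : realType.
Local Notation C := (Cx R).

(* Values on the Riemann sphere: [Some w] is the finite value w, [None] is oo. *)
Definition oval (f : C -> option C) (z : C) : C := odflt 0 (f z).

Definition domain (D : set C) : Prop := open D /\ connected D /\ D !=set0.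

Definition holo_near (g : C -> C) (z0 : C) : Prop :=
  \forall z \near z0, derivable g z 1.

(* f : C -> C u {oo} is meromorphic on D: its poles (value oo) do not
   accumulate in D, f is complex differentiable at every non-pole of D,
   and at every pole |f| -> oo (i.e. 1/f -> 0). *)
Definition meromorphic_on (D : set C) (f : C -> option C) : Prop :=
  [/\ (forall z0, D z0 -> \forall z \near z0^', f z != None),
      (forall z0, D z0 -> f z0 != None -> derivable (oval f) z0 1) &
      (forall z0, D z0 -> f z0 = None ->
         (fun z => (oval f z)^-1) @ z0^' --> (0 : C))].

(* Pointwise operations on extended-valued functions (only their values
   off a discrete set matter below). *)
Definition osub (f g : C -> option C) (z : C) : option C :=
  match f z, g z with Some a, Some b => Some (a - b) | _, _ => None end.
Definition oinv (f : C -> option C) (z : C) : option C :=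
  match f z with
  | None => Some 0
  | Some a => if a == 0 then None else Some a^-1
  end.
Definition odiv (f g : C -> option C) (z : C) : option C :=
  match f z, g z with
  | Some a, Some b => if b == 0 then None else Some (a / b)
  | _, _ => None
  end.
Definition ocst (c : C) : C -> option C := fun _ => Some c.

(* phi (meromorphic near z0) has a zero of order m at z0:
   phi z = (z - z0)^m h z near z0 with h holomorphic at z0, h z0 <> 0
   (stated on a punctured neighbourhood, i.e. after removing removable
   singularities, as for the meromorphic function phi). *)
Definition zero_of_order (phi : C -> option C) (z0 : C) (m : nat) : Prop :=
  exists h : C -> C, [/\ holo_near h z0, h z0 != 0 &
    \forall z \near z0^', phi z = Some ((z - z0) ^+ m * h z)].

Definition share_CM_value (D : set C) (f g alpha : C -> option C) : Prop :=
  forall z0, D z0 ->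
    (alpha z0 != None -> forall m : nat, (0 < m)%N ->
       zero_of_order (osub f alpha) z0 m <-> zero_of_order (osub g alpha) z0 m) /\
    (alpha z0 = None -> forall m : nat, (0 < m)%N ->
       zero_of_order (osub (oinv f) (oinv alpha)) z0 m <->
       zero_of_order (osub (oinv g) (oinv alpha)) z0 m).

End Mero.

(* Main.v *)
(* If f/alpha - 1 has a zero of order m at z0, then alpha is finite and nonzero
   on a punctured neighbourhood of z0.  Put u = alpha if alpha(z0) is finite and
   u = 1/alpha otherwise: then u is continuous at z0, holomorphic and nonvanishing
   around z0, so u = (z - z0)^k b with b holomorphic and b(z0) != 0.  Hence
   f - alpha = alpha (f/alpha - 1), resp. 1/f - 1/alpha = - u (f/alpha - 1) / (f/alpha),
   has a zero of order m + k > 0; sharing moves it to g, and the same k is taken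
   off again.

   The factorization of u is proved from complex differentiability alone:
   Goursat's lemma on rectangles (with isolated exceptional points), then
   u(w) N(w) = \oint u(z)/(z - w) dz over a square, with N(w) = \oint dz/(z - w).
   This makes isolated continuous singularities removable, so u can be divided by
   z - z0 as long as it vanishes there, and it bounds every quotient u/(z - z0)^k
   near z0 by its values on the square, so the division stops. *)
Require Import Defs.
From HB Require Import structures.
From mathcomp Require Import all_boot all_order all_algebra.
From mathcomp Require Import all_classical all_reals all_analysis.
From mathcomp Require Import complex.
From mathcomp Require Import ring lra.
Import Order.TTheory GRing.Theory Num.Theory.
Import numFieldNormedType.Exports.
Local Open Scope classical_set_scope.
Local Open Scope ring_scope.
Set Implicit Arguments.
Unset Strict Implicit.

(** * Integrals of continuous real functions *)

Section RealIntegral.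
Variable R : realType.
Implicit Types (phi psi Phi Psi : R -> R) (a b c : R).

Definition antiderivative phi Phi := forall x : R, is_derive x 1 Phi (phi x).

(** The difference has derivative 0, so the mean value theorem makes it constant. Everything stays
    inside a symmetric interval, so that antiderivatives known only on a bounded interval can be
    compared. *)
Lemma antiderivative_diff phi Phi Psi a b :
  (forall x : R, `|x| < b -> is_derive x 1 Phi (phi x)) ->
  (forall x : R, `|x| < b -> is_derive x 1 Psi (phi x)) ->
  `|a| < b -> Phi a - Phi 0 = Psi a - Psi 0.
Proof.
move=> dP dQ ab.
pose D x := Phi x - Psi x.
have d (x : R) : `|x| < b -> is_derive x 1 D (0 : R).
  move=> xb; have hP := dP _ xb; have hQ := dQ _ xb.
  by rewrite -(subrr (phi x)); exact: is_deriveB.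
have H (x y : R) : x <= y -> `|x| < b -> `|y| < b -> D y = D x.
  move=> xy xb yb.
  have dd (z : R) : z \in `[x, y] -> is_derive z 1 D (0 : R).
    rewrite in_itv/= => /andP[xz zy]; apply: d.
    by move: xb yb; rewrite !ltr_norml => /andP[? ?] /andP[? ?]; apply/andP; split; lra.
  have dd' (z : R) : z \in `]x, y[ -> is_derive z 1 D ((fun=> 0 : R) z).
    by move=> zI; apply: dd; move: zI; rewrite !in_itv/= => /andP[/ltW -> /ltW ->].
  have cD : {within `[x, y], continuous D}.
    by apply: derivable_within_continuous => z /dd[].
  have [c cI] := MVT_segment xy dd' cD.
  by rewrite mul0r => /eqP; rewrite subr_eq0 => /eqP.
have b0 : `|0 : R| < b by rewrite normr0 (le_lt_trans _ ab).
have : D a = D 0.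
  by case: (leP 0 a) => [|/ltW] h; [exact: H|symmetry; exact: H].
rewrite /D; lra.
Qed.

(** The fundamental theorem of calculus gives an antiderivative on each bounded symmetric interval.
    Normalized to vanish at 0, these agree on overlaps; at [x] the one indexed by the integer part
    [N x] of the absolute value is used. *)
Lemma antiderivative_exists phi : continuous phi ->
  exists Phi, antiderivative phi Phi.
Proof.
move=> cphi.
have P (n : R) : 0 < n -> exists Phi, forall x : R, `|x| < n -> is_derive x 1 Phi (phi x).
  move=> n0; pose F x := (\int[lebesgue_measure]_(t in `[(- n)%R, x]) phi t)%R.
  exists F => x; rewrite ltr_norml => /andP[nx xn].
  have int : (lebesgue_measure).-integrable `[(- n)%R, n] (EFin \o phi).
    apply: continuous_compact_integrable; first exact: segment_compact.
    by apply: continuous_subspaceT.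
  have ax : (BLeft (- n)%R < BRight x)%E by rewrite lte_fin.
  have [] := continuous_FTC1 xn int ax (cphi x).
  by rewrite derive1E => ? <-; exact: DeriveDef.
have {}P (n : nat) : exists Phi, forall x : R, `|x| < n.+1%:R -> is_derive x 1 Phi (phi x).
  exact: P.
have [F FP] := choice P.
pose N (x : R) := Num.truncn `|x|.
have NP x : `|x| < (N x).+1%:R by exact: truncnS_gt.
exists (fun x => F (N x) x - F (N x) 0) => x.
(* [N] jumps at integers, so the two normalized antiderivatives are compared on the smaller of their
   intervals. *)
have e : \forall y \near x, F (N x) y - F (N x) 0 = F (N y) y - F (N y) 0.
  near=> y.
  have yx : `|y| < (N x).+1%:R.
    by near: y; apply: (cvgr_lt `|x|) => //; apply: cvg_norm.
  case: (leqP (N x) (N y)) => [le|/ltnW le].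
    apply: (@antiderivative_diff phi _ _ y (N x).+1%:R) => //; first exact: FP.
    by move=> z zx; apply: FP; rewrite (lt_le_trans zx)// ler_nat.
  apply: (@antiderivative_diff phi _ _ y (N y).+1%:R) => //; last exact: FP.
  by move=> z zx; apply: FP; rewrite (lt_le_trans zx)// ler_nat.
have dF : is_derive x 1 (fun y => F (N x) y - F (N x) 0) (phi x).
  by rewrite -[phi x]subr0; apply: is_deriveB; exact: FP.
by apply: near_eq_is_derive dF; exact: e.
Unshelve. all: by end_near. Qed.

(* Meaningful only when phi has an antiderivative, e.g. when phi is continuous. *)
Definition integ phi a b : R :=
  let Phi := xget (cst 0) [set Phi | antiderivative phi Phi] in Phi b - Phi a.

Lemma integ_chasles phi a b c : integ phi a b + integ phi b c = integ phi a c.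
Proof. by rewrite /integ addrC addrA subrK. Qed.

Lemma integP phi : continuous phi ->
  exists2 Phi, antiderivative phi Phi & forall a b, integ phi a b = Phi b - Phi a.
Proof.
move=> /antiderivative_exists[Psi dPsi].
exists (xget (cst 0) [set Phi | antiderivative phi Phi]); last by [].
exact: (@xgetI _ (cst 0) [set Phi | antiderivative phi Phi] Psi).
Qed.

Lemma integE phi Psi a b : continuous phi -> antiderivative phi Psi ->
  integ phi a b = Psi b - Psi a.
Proof.
move=> /integP[Phi dPhi ->] dPsi.
have H x : Phi x - Phi 0 = Psi x - Psi 0.
  apply: (@antiderivative_diff phi _ _ x (`|x| + 1)) => //.
  by rewrite ltrDl.
by have := H a; have := H b; lra.
Qed.

Lemma integ_lin (k : R) phi psi a b : continuous phi -> continuous psi ->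
  integ (fun t => k * phi t + psi t) a b = k * integ phi a b + integ psi a b.
Proof.
move=> cf cg; have [F dF ->] := integP cf; have [G dG ->] := integP cg.
rewrite (@integE _ (fun t => k * F t + G t)).
- by ring.
- by move=> x; apply: cvgD; [apply: cvgMr; exact: cf|exact: cg].
- move=> x; have hF := dF x; have hG := dG x.
  have := is_deriveD (is_deriveZ k hF) hG.
  by apply.
Qed.

Lemma integ_cst k a b : integ (fun=> k) a b = k * (b - a).
Proof.
rewrite (@integE _ (fun t => k * t)); [by ring|by move=> t; exact: cvg_cst|].
by move=> x; rewrite -[X in is_derive _ _ _ X]mulr1; exact: is_deriveZ.
Qed.

Lemma integ_id a b : integ id a b = (b ^+ 2 - a ^+ 2) / 2.
Proof.
rewrite (@integE _ (fun t => 2^-1 * t ^+ 2)); [by field|by move=> t; exact: cvg_id|].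
move=> x; have H : is_derive x 1 (fun t : R => t * t) (x *: 1 + x *: 1).
  exact: is_deriveM.
rewrite (_ : (fun _ => _) = 2^-1 \*: (fun t : R => t * t)); last first.
  by apply/funext => t; rewrite expr2.
have := is_deriveZ 2^-1 H; rewrite (_ : _ *: _ = x)//.
by rewrite /GRing.scale/=; field.
Qed.

(** The mean value theorem, applied to an antiderivative, writes the integral as
    [phi c * (b - a)]. *)
Lemma integ_bound phi a b M : a <= b -> continuous phi ->
  (forall t, a <= t <= b -> `|phi t| <= M) -> `|integ phi a b| <= M * (b - a).
Proof.
move=> ab cf le; have [F dF ->] := integP cf.
have cF : {within `[a, b], continuous F}.
  by apply: derivable_within_continuous => z _; have [] := dF z.
have [c cI ->] := MVT_segment ab (fun z _ => dF z) cF.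
rewrite in_itv/= in cI.
rewrite normrM (ger0_norm (_ : 0 <= b - a)) ?subr_ge0//.
by rewrite ler_wpM2r ?subr_ge0// le.
Qed.

Lemma integ_between phi a b m M : a <= b -> continuous phi ->
  (forall t, a <= t <= b -> m <= phi t <= M) ->
  m * (b - a) <= integ phi a b <= M * (b - a).
Proof.
move=> ab cf le; have [F dF ->] := integP cf.
have cF : {within `[a, b], continuous F}.
  by apply: derivable_within_continuous => z _; have [] := dF z.
have [c cI ->] := MVT_segment ab (fun z _ => dF z) cF.
rewrite in_itv/= in cI; have /andP[? ?] := le _ cI.
by rewrite !ler_wpM2r ?subr_ge0.
Qed.

End RealIntegral.

(** * Modulus, continuity and derivability in the complex plane *)

Local Notation re := (@complex.Re _).
Local Notation im := (@complex.Im _).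

Section ComplexNorm.
Variable R : realType.
Local Notation C := (Cx R).
Implicit Types (z w : C) (x y : R).

Definition mkC x y : C := Complex x y.
(* The modulus as a real number: [`|z|] lives in the complex field itself. *)
Definition nm z : R := ComplexField.Normc.normc z.

Lemma ReC x y : re (mkC x y) = x. Proof. by []. Qed.
Lemma ImC x y : im (mkC x y) = y. Proof. by []. Qed.
Lemma ReD z w : re (z + w) = re z + re w. Proof. by move: z w => [? ?] [? ?]. Qed.
Lemma ImD z w : im (z + w) = im z + im w. Proof. by move: z w => [? ?] [? ?]. Qed.
Lemma ReN z : re (- z) = - re z. Proof. by case: z. Qed.
Lemma ImN z : im (- z) = - im z. Proof. by case: z. Qed.
Lemma ReM z w : re (z * w) = re z * re w - im z * im w. Proof. by move: z w => [? ?] [? ?]. Qed.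
Lemma ImM z w : im (z * w) = re z * im w + im z * re w. Proof. by move: z w => [? ?] [? ?]. Qed.
Lemma Re0 : re (0 : C) = 0. Proof. by []. Qed.
Lemma Im0 : im (0 : C) = 0. Proof. by []. Qed.
Lemma Re1 : re (1 : C) = 1. Proof. by []. Qed.
Lemma Im1 : im (1 : C) = 0. Proof. by []. Qed.
Lemma C_eq z w : re z = re w -> im z = im w -> z = w.
Proof. by move: z w => [? ?] [? ?] /= -> ->. Qed.
Definition CE := (ReC, ImC, ReD, ImD, ReN, ImN, ReM, ImM, Re0, Im0, Re1, Im1).

Lemma nmE z : `|z| = mkC (nm z) 0. Proof. by []. Qed.
Lemma nm_ge0 z : 0 <= nm z.
Proof. by case: z => a b; exact: sqrtr_ge0. Qed.
Lemma nm0 : nm 0 = 0. Proof. exact: ComplexField.Normc.normc0. Qed.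
Lemma nm1 : nm 1 = 1. Proof. exact: ComplexField.Normc.normc1. Qed.
Lemma nmM z w : nm (z * w) = nm z * nm w. Proof. exact: ComplexField.Normc.normcM. Qed.
Lemma nmV z : nm z^-1 = (nm z)^-1. Proof. exact: ComplexField.Normc.normcV. Qed.
Lemma nmN z : nm (- z) = nm z. Proof. exact: normcN. Qed.
Lemma nmD z w : nm (z + w) <= nm z + nm w. Proof. exact: le_normcD. Qed.
Lemma nmB z w : nm (z - w) <= nm z + nm w. Proof. by rewrite -(nmN w) nmD. Qed.
Lemma nmX z n : nm (z ^+ n) = nm z ^+ n.
Proof. by elim: n => [|n IH]; rewrite ?expr0 ?nm1// !exprS nmM IH. Qed.
Lemma nm_distC z w : nm (z - w) = nm (w - z). Proof. by rewrite -nmN opprB. Qed.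
Lemma nm_eq0 z : (nm z == 0) = (z == 0).
Proof. by apply/eqP/eqP => [/ComplexField.Normc.eq0_normc|->] //; exact: nm0. Qed.
Lemma nm_gt0 z : (0 < nm z) = (z != 0).
Proof. by rewrite lt_neqAle nm_ge0 andbT eq_sym nm_eq0. Qed.
Lemma nm_real x : nm (mkC x 0) = `|x|.
Proof. by rewrite /nm /= expr0n addr0 sqrtr_sqr. Qed.
Lemma nm_sqr z : nm z ^+ 2 = re z ^+ 2 + im z ^+ 2.
Proof. by case: z => a b; rewrite /nm /= sqr_sqrtr// addr_ge0 ?sqr_ge0. Qed.
Lemma Re_le_nm z : `|re z| <= nm z.
Proof.
by rewrite -(ler_pXn2r (n:=2)) ?nnegrE ?nm_ge0// nm_sqr real_normK ?num_real// lerDl sqr_ge0.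
Qed.
Lemma Im_le_nm z : `|im z| <= nm z.
Proof.
by rewrite -(ler_pXn2r (n:=2)) ?nnegrE ?nm_ge0// nm_sqr real_normK ?num_real// lerDr sqr_ge0.
Qed.
Lemma nm_le_ReIm z : nm z <= `|re z| + `|im z|.
Proof.
rewrite -(ler_pXn2r (n:=2)) ?nnegrE ?nm_ge0 ?addr_ge0// nm_sqr.
have := normr_ge0 (re z); have := normr_ge0 (im z).
rewrite -(real_normK (num_real (re z))) -(real_normK (num_real (im z))).
set a := `|re z|; set b := `|im z|; nra.
Qed.

(** The order of [C] compares only numbers with equal imaginary parts, so a positive radius is real.
    This moves every epsilon and every radius to [R]. *)
Lemma ltC_real (e : C) : 0 < e -> exists2 d : R, 0 < d & e = mkC d 0.
Proof.
move=> e0; exists (nm e); first by rewrite nm_gt0 gt_eqF.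
by rewrite -nmE gtr0_norm.
Qed.
Lemma ltCE z (d : R) : (`|z| < mkC d 0) = (nm z < d).
Proof. by rewrite nmE; exact: ltcR. Qed.
Lemma leCE z (d : R) : (`|z| <= mkC d 0) = (nm z <= d).
Proof. by rewrite nmE; exact: lecR. Qed.
Lemma mkC_gt0 (d : R) : (0 < mkC d 0) = (0 < d).
Proof. exact: (ltcR 0 d). Qed.

Lemma nearC z (P : set C) : (\forall y \near z, P y) <->
  exists2 d : R, 0 < d & forall y : C, nm (y - z) < d -> P y.
Proof.
split=> [/nbhs_ballP[e /= e0 eP]|[d d0 dP]].
  have [d d0 ed] := ltC_real e0; exists d => // y yd; apply: eP.
  by rewrite -ball_normE /= ed distrC ltCE.
apply/nbhs_ballP; exists (mkC d 0); first by rewrite /= mkC_gt0.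
by move=> y; rewrite -ball_normE /= distrC ltCE; exact: dP.
Qed.

Lemma dnearC z (P : set C) : (\forall y \near z^', P y) <->
  exists2 d : R, 0 < d & forall y : C, y != z -> nm (y - z) < d -> P y.
Proof.
rewrite near_withinE; apply: (iff_trans (nearC _ _)).
by split=> -[d d0 dP]; exists d => // y; move=> *; apply: dP.
Qed.

Lemma contC (F : C -> C) z : {for z, continuous F} <->
  forall e : R, 0 < e -> exists2 d : R, 0 < d &
    forall y : C, nm (y - z) < d -> nm (F y - F z) < e.
Proof.
split=> [cF e e0|H].
  have := cF; move=> /cvgrPdist_lt/(_ (mkC e 0)); rewrite mkC_gt0 => /(_ e0).
  by move=> /nearC[d d0 H]; exists d => // y /H; rewrite distrC ltCE.
apply: (@cvgrPdist_lt _ _ _ _ (nbhs_filter z) F (F z)).2 => e /ltC_real[d d0 ->].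
have [f f0 fP] := H d d0.
by apply/nearC; exists f => // y /fP; rewrite distrC ltCE.
Qed.

Lemma nm_quotient (A D h : C) : h != 0 -> nm (A - D * h) = nm (D - h^-1 * A) * nm h.
Proof.
by move=> h0; rewrite -nmM mulrBl mulrAC mulVf// mul1r nm_distC.
Qed.

(** The difference quotient is multiplied out by [y - z], which avoids division and makes the
    estimate trivial at [y = z]. *)
Lemma derivableC (F : C -> C) z : derivable F z 1 <->
  exists D : C, forall e : R, 0 < e -> exists2 d : R, 0 < d &
    forall y : C, nm (y - z) < d -> nm (F y - F z - D * (y - z)) <= e * nm (y - z).
Proof.
split.
  move=> /cvg_ex[D /cvgrPdist_lt H]; exists D => e e0.
  have := H (mkC e 0); rewrite mkC_gt0 => /(_ e0) /dnearC[d d0 dP].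
  exists d => // y yd.
  have [->|yz] := eqVneq y z.
    by rewrite !subrr mulr0 subrr nm0 mulr0.
  have yz0 : y - z != 0 by rewrite subr_eq0.
  have := dP (y - z); rewrite subr0 => /(_ yz0 yd).
  rewrite [(F \o shift z) _]/= [(y - z)%:A]mulr1 subrK ltCE => /ltW h.
  by rewrite nm_quotient// ler_wpM2r ?nm_ge0.
move=> [D H]; apply/cvg_ex; exists D.
apply: (@cvgrPdist_le _ _ _ _ (dnbhs_filter 0) _ _).2 => e /ltC_real[d d0 ->].
have [f f0 fP] := H d d0.
apply/dnearC; exists f => // y y0; rewrite subr0 => yf.
have := fP (y + z); rewrite addrK => /(_ yf).
rewrite [y%:A]mulr1 leCE nm_quotient//.
by rewrite ler_pM2r ?nm_gt0.
Qed.

Lemma derivable_contC (F : C -> C) z : derivable F z 1 -> {for z, continuous F}.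
Proof. by move=> /derivable1_diffP/differentiable_continuous. Qed.

(** Meant for paths [l] running along a horizontal or vertical line at unit speed. *)
Lemma cont_line (F : C -> C) (l : R -> C) :
  (forall t, {for l t, continuous F}) ->
  (forall s t, nm (l s - l t) <= `|s - t|) ->
  continuous (fun t => re (F (l t))) /\ continuous (fun t => im (F (l t))).
Proof.
move=> cF hl.
have H t e : 0 < e -> \forall s \near t, nm (F (l t) - F (l s)) < e.
  move=> e0; have [d d0 dP] := (contC F (l t)).1 (cF t) e e0.
  apply: filterS (nbhsx_ballx t d d0) => s; rewrite -ball_normE /= => ts.
  by rewrite nm_distC; apply: dP; rewrite (le_lt_trans (hl _ _))// distrC.
split=> t; apply/cvgrPdist_lt => e e0; near=> s.
  by rewrite -ReN -ReD (le_lt_trans (Re_le_nm _))//; near: s; exact: H.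
by rewrite -ImN -ImD (le_lt_trans (Im_le_nm _))//; near: s; exact: H.
Unshelve. all: by end_near. Qed.

End ComplexNorm.
Arguments nm {R} z : simpl never.
Arguments derivable_contC {R F z} _.

(** * Algebra of complex derivable functions *)

Section ComplexDerivable.
Variable R : realType.
Local Notation C := (Cx R).
Implicit Types (F G : C -> C) (z : C).

Lemma derC_add F G z : derivable F z 1 -> derivable G z 1 ->
  derivable (fun z => F z + G z) z 1.
Proof. exact: derivableD. Qed.
Lemma derC_sub F G z : derivable F z 1 -> derivable G z 1 ->
  derivable (fun z => F z - G z) z 1.
Proof. exact: derivableB. Qed.
Lemma derC_mul F G z : derivable F z 1 -> derivable G z 1 ->
  derivable (fun z => F z * G z) z 1.
Proof. exact: derivableM. Qed.
Lemma derC_inv F z : F z != 0 -> derivable F z 1 ->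
  derivable (fun z => (F z)^-1) z 1.
Proof. exact: derivableV. Qed.
Lemma derC_cst (k : C) z : derivable (fun=> k : C) z 1.
Proof. exact: derivable_cst. Qed.
Lemma derC_id z : derivable (fun z : C => z) z 1.
Proof. exact: derivable_id. Qed.
Lemma derC_ext F G z : (\forall y \near z, F y = G y) ->
  derivable F z 1 -> derivable G z 1.
Proof. exact: near_eq_derivable. Qed.

Lemma derC_exp F z n : derivable F z 1 -> derivable (fun z => F z ^+ n) z 1.
Proof.
move=> dF; elim: n => [|n IH].
  apply: (@derC_ext (fun=> 1)); last exact: derC_cst.
  by apply/nearC; exists 1 => // y _; rewrite expr0.
have e : \forall y \near z, F y * F y ^+ n = F y ^+ n.+1.
  by apply/nearC; exists 1 => // y _; rewrite exprS.
have H := derC_mul dF IH.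
exact: (derC_ext e H).
Qed.

End ComplexDerivable.
Arguments derC_add {R F G z} _ _.
Arguments derC_sub {R F G z} _ _.
Arguments derC_mul {R F G z} _ _.
Arguments derC_inv {R F z} _ _.
Arguments derC_cst {R} k z.
Arguments derC_id {R} z.
Arguments derC_exp {R F z} n _.
Arguments derC_ext {R F G z} _ _.

(** * Integrals along rectangles *)

Section ContourIntegral.
Variable R : realType.
Local Notation C := (Cx R).
Implicit Types (f g : R -> C) (F G : C -> C) (a b c d : R).

Definition ccont f := continuous (fun t => re (f t)) /\ continuous (fun t => im (f t)).

Definition cinteg f a b : C :=
  mkC (integ (fun t => re (f t)) a b) (integ (fun t => im (f t)) a b).

Lemma cinteg_chasles f a b c : cinteg f a b + cinteg f b c = cinteg f a c.
Proof. by apply: C_eq; rewrite !CE integ_chasles. Qed.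

Lemma cinteg_lin (k : C) f g a b : ccont f -> ccont g ->
  cinteg (fun t => k * f t + g t) a b = k * cinteg f a b + cinteg g a b.
Proof.
move=> [f1 f2] [g1 g2]; apply: C_eq; rewrite !CE.
  rewrite (_ : (fun t => _) = (fun t => re k * re (f t) + (- im k * im (f t) + re (g t)))).
    rewrite integ_lin// ?integ_lin//; first by ring.
    by move=> x; apply: cvgD; [apply: cvgMr; exact: f2|exact: g1].
  by apply/funext => t; rewrite !CE; ring.
rewrite (_ : (fun t => _) = (fun t => re k * im (f t) + (im k * re (f t) + im (g t)))).
  rewrite integ_lin// ?integ_lin//; first by ring.
  by move=> x; apply: cvgD; [apply: cvgMr; exact: f1|exact: g2].
by apply/funext => t; rewrite !CE; ring.
Qed.

Lemma ccont_lin (k : C) f g : ccont f -> ccont g -> ccont (fun t => k * f t + g t).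
Proof.
move=> [f1 f2] [g1 g2]; split.
  rewrite (_ : (fun t => _) = (fun t => re k * re (f t) - im k * im (f t) + re (g t))).
    move=> x; apply: cvgD; last exact: g1.
    by apply: cvgB; apply: cvgMr; [exact: f1|exact: f2].
  by apply/funext => t; rewrite !CE; ring.
rewrite (_ : (fun t => _) = (fun t => re k * im (f t) + im k * re (f t) + im (g t))).
  move=> x; apply: cvgD; last exact: g2.
  by apply: cvgD; apply: cvgMr; [exact: f2|exact: f1].
by apply/funext => t; rewrite !CE; ring.
Qed.

(** Real and imaginary parts are bounded separately, hence the factor 2. *)
Lemma cinteg_bound f a b M : a <= b -> ccont f ->
  (forall t, a <= t <= b -> nm (f t) <= M) -> nm (cinteg f a b) <= 2 * M * (b - a).
Proof.
move=> ab [f1 f2] fM; rewrite (le_trans (nm_le_ReIm _))//= mulrAC mulr_natl mulr2n mulrDl.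
rewrite ![(b - a) * M]mulrC; apply: lerD; apply: integ_bound => // t /fM; apply: le_trans.
  exact: Re_le_nm.
exact: Im_le_nm.
Qed.

Lemma ccont_cst (k : C) : ccont (fun=> k).
Proof. by split=> t; exact: cvg_cst. Qed.

Lemma ccont_id : ccont (fun t => mkC t 0).
Proof. by split=> t; [exact: cvg_id|exact: cvg_cst]. Qed.

Lemma cinteg_cst (k : C) a b : cinteg (fun=> k) a b = k * mkC (b - a) 0.
Proof. by apply: C_eq; rewrite !CE /= integ_cst; ring. Qed.

Lemma cinteg_affine (A B : C) a b : cinteg (fun t => A * mkC t 0 + B) a b =
  A * mkC ((b ^+ 2 - a ^+ 2) / 2) 0 + B * mkC (b - a) 0.
Proof.
rewrite cinteg_lin; [|exact: ccont_id|exact: ccont_cst].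
rewrite cinteg_cst; congr (_ * _ + _).
by rewrite /cinteg /= (integ_id a b) integ_cst mul0r.
Qed.

Definition iC : C := mkC 0 1.

(* The counterclockwise integral of F along the boundary of [a,b] x [c,d]. *)
Definition rint F a b c d : C :=
  cinteg (fun t => F (mkC t c)) a b - cinteg (fun t => F (mkC t d)) a b
  + iC * (cinteg (fun t => F (mkC b t)) c d - cinteg (fun t => F (mkC a t)) c d).

(** Continuity is asked along the whole lines carrying the sides, because [integ] relies on
    antiderivatives on all of [R]. For the same reason [bline] below consists of four full lines,
    while [bdR] is the actual boundary. *)
Definition okb F a b c d :=
  [/\ ccont (fun t => F (mkC t c)), ccont (fun t => F (mkC t d)),
      ccont (fun t => F (mkC a t)) & ccont (fun t => F (mkC b t))].

Definition inR a b c d (z : C) := (a <= re z <= b) && (c <= im z <= d).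
Definition bline a b c d (z : C) := [|| re z == a, re z == b, im z == c | im z == d].

Definition bdR a b c d (z : C) := inR a b c d z && bline a b c d z.

Lemma ccont_hline F c : (forall t, {for mkC t c, continuous F}) ->
  ccont (fun t => F (mkC t c)).
Proof.
move=> cF; apply: (cont_line (l := fun t => mkC t c)) => // s t.
by rewrite (_ : _ - _ = mkC (s - t) 0) ?nm_real//; apply: C_eq; rewrite !CE ?subrr.
Qed.

Lemma ccont_vline F a : (forall t, {for mkC a t, continuous F}) ->
  ccont (fun t => F (mkC a t)).
Proof.
move=> cF; apply: (cont_line (l := fun t => mkC a t)) => // s t.
rewrite (_ : _ - _ = iC * mkC (s - t) 0).
  by rewrite nmM nm_real /nm /= expr0n expr1n add0r sqrtr1 mul1r.
by apply: C_eq; rewrite !CE /=; ring.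
Qed.

Lemma okb_bline F a b c d : (forall z, bline a b c d z -> {for z, continuous F}) ->
  okb F a b c d.
Proof.
by move=> cF; split; (apply: ccont_hline || apply: ccont_vline) => t; apply: cF;
  rewrite /bline /= eqxx ?orbT.
Qed.

Lemma okb_cont F a b c d : continuous F -> okb F a b c d.
Proof. by move=> cF; apply: okb_bline => z _; exact: cF. Qed.

Lemma rint_ext F G a b c d : (forall z, bline a b c d z -> F z = G z) ->
  rint F a b c d = rint G a b c d.
Proof.
move=> FG; rewrite /rint; congr (_ - _ + _ * (_ - _)); congr cinteg;
  by apply/funext => t; apply: FG; rewrite /bline /= eqxx ?orbT.
Qed.

Lemma rint_degv F a c d : rint F a a c d = 0.
Proof.
by rewrite /rint /cinteg /integ !subrr !mulr0 addr0.
Qed.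

Lemma rint_degh F a b c : rint F a b c c = 0.
Proof.
by rewrite /rint /cinteg /integ !subrr add0r mulr0.
Qed.

Lemma rint_lin (k : C) F G a b c d : okb F a b c d -> okb G a b c d ->
  rint (fun z => k * F z + G z) a b c d = k * rint F a b c d + rint G a b c d.
Proof.
move=> [? ? ? ?] [? ? ? ?]; rewrite /rint !cinteg_lin//; ring.
Qed.

Lemma okb_lin (k : C) F G a b c d : okb F a b c d -> okb G a b c d ->
  okb (fun z => k * F z + G z) a b c d.
Proof.
by move=> [? ? ? ?] [? ? ? ?]; split; exact: ccont_lin.
Qed.

Lemma nm_iC : nm iC = 1.
Proof. by rewrite /nm /= expr0n expr1n add0r sqrtr1. Qed.

(** The constant 8 is four sides times the factor 2 of [cinteg_bound]. *)
Lemma rint_bound F a b c d L M : a <= b -> c <= d -> b - a <= L -> d - c <= L ->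
  okb F a b c d -> (forall z, bdR a b c d z -> nm (F z) <= M) ->
  nm (rint F a b c d) <= 8 * M * L.
Proof.
move=> ab cd abL cdL [h1 h2 h3 h4] FM.
have M0 : 0 <= M.
  apply: le_trans (FM (mkC a c) _); first exact: nm_ge0.
  by rewrite /bdR /bline /inR /= !lexx ab cd eqxx.
have P f x y : ccont f -> x <= y -> y - x <= L -> (forall t, x <= t <= y -> nm (f t) <= M) ->
    nm (cinteg f x y) <= 2 * M * L.
  move=> cf xy yxL fM; apply: le_trans (cinteg_bound xy cf fM) _.
  by rewrite ler_wpM2l// mulr_ge0.
have H1 := P _ _ _ h1 ab abL; have H2 := P _ _ _ h2 ab abL.
have H3 := P _ _ _ h3 cd cdL; have H4 := P _ _ _ h4 cd cdL.
rewrite /rint (le_trans (nmD _ _))// nmM nm_iC mul1r.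
rewrite (_ : 8 * M * L = (2 * M * L + 2 * M * L) + (2 * M * L + 2 * M * L)); last by ring.
apply: lerD; apply: (le_trans (nmB _ _)); apply: lerD.
- by apply: H1 => t tab; apply: FM; rewrite /bdR /bline /inR /= tab lexx cd eqxx !orbT.
- by apply: H2 => t tab; apply: FM; rewrite /bdR /bline /inR /= tab lexx cd eqxx !orbT.
- by apply: H4 => t tab; apply: FM; rewrite /bdR /bline /inR /= tab lexx ab eqxx !orbT.
- by apply: H3 => t tab; apply: FM; rewrite /bdR /bline /inR /= tab lexx ab eqxx.
Qed.

(** The integrals along the common vertical side cancel, being run in opposite directions. *)
Lemma rint_splitv F x a b c d : rint F a b c d = rint F a x c d + rint F x b c d.
Proof.
rewrite /rint -(cinteg_chasles (fun t => F (mkC t c)) a x b).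
by rewrite -(cinteg_chasles (fun t => F (mkC t d)) a x b); ring.
Qed.

Lemma rint_splith F y a b c d : rint F a b c d = rint F a b c y + rint F a b y d.
Proof.
rewrite /rint -(cinteg_chasles (fun t => F (mkC a t)) c y d).
by rewrite -(cinteg_chasles (fun t => F (mkC b t)) c y d); ring.
Qed.

(** The side integrals have closed forms that cancel. This allows the affine part of a function to
    be subtracted in Goursat's lemma. *)
Lemma rint_affine (A B : C) a b c d : rint (fun z => A * z + B) a b c d = 0.
Proof.
have h y : cinteg (fun t => A * mkC t y + B) a b =
    A * mkC ((b ^+ 2 - a ^+ 2) / 2) 0 + (A * mkC 0 y + B) * mkC (b - a) 0.
  rewrite -cinteg_affine; congr cinteg; apply/funext => t.
  by apply: C_eq; rewrite !CE; ring.
have v x : cinteg (fun t => A * mkC x t + B) c d =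
    (A * iC) * mkC ((d ^+ 2 - c ^+ 2) / 2) 0 + (A * mkC x 0 + B) * mkC (d - c) 0.
  rewrite -cinteg_affine; congr cinteg; apply/funext => t.
  by apply: C_eq; rewrite !CE; ring.
by rewrite /rint !h !v; apply: C_eq; rewrite !CE; field.
Qed.

End ContourIntegral.
Arguments rint {R} F a b c d : simpl never.

(** * Goursat's lemma on rectangles *)

Section Goursat.
Variable R : realType.
Local Notation C := (Cx R).
Implicit Types (F : C -> C) (a b c d : R).

(** Every left endpoint lies below every right endpoint, so the supremum of the left endpoints is a
    common point. *)
Lemma nested_intervals (x w : nat -> R) :
  (forall n, 0 <= w n) -> (forall n, x n <= x n.+1) ->
  (forall n, x n.+1 + w n.+1 <= x n + w n) ->
  exists X, forall n, x n <= X <= x n + w n.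
Proof.
move=> w0 xS xwS.
have x_mono m n : (m <= n)%N -> x m <= x n.
  by move=> /subnK <-; elim: (n - m)%N => // k IH; rewrite addSn (le_trans IH).
have xw_mono m n : (m <= n)%N -> x n + w n <= x m + w m.
  by move=> /subnK <-; elim: (n - m)%N => // k IH; rewrite addSn (le_trans _ IH).
have le m n : x m <= x n + w n.
  case: (leqP m n) => [/x_mono h|/ltnW/xw_mono h].
    by rewrite (le_trans h)// lerDl.
  by rewrite (le_trans _ h)// lerDl.
exists (sup (range x)) => n; apply/andP; split.
  by apply: ub_le_sup; [exists (x 0 + w 0) => _ [m _ <-]; exact: le|exists n].
by apply: ge_sup; [exists (x 0), 0|move=> _ [m _ <-]; exact: le].
Qed.

Lemma affine_continuous (A B : C) : continuous (fun z => A * z + B).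
Proof.
move=> z; apply: derivable_contC; apply: derC_add; last exact: derC_cst.
by apply: derC_mul; [exact: derC_cst|exact: derC_id].
Qed.

Lemma rint_sub_affine (A B : C) F a b c d : continuous F ->
  okb (fun z => F z - (A * z + B)) a b c d /\
  rint F a b c d = rint (fun z => F z - (A * z + B)) a b c d.
Proof.
move=> cF; have okF := okb_cont a b c d cF.
have okG := okb_cont a b c d (@affine_continuous A B).
have E : (fun z => -1 * (A * z + B) + F z) = (fun z => F z - (A * z + B)).
  by apply/funext => z; rewrite mulN1r addrC.
rewrite -E; split; first exact: okb_lin okG okF.
have h := rint_lin (-1) okG okF.
by rewrite rint_affine mulr0 add0r in h; rewrite h.
Qed.

(* Bisection: some quarter carries at least a quarter of the integral; at the limit
   point F is affine up to an error o(side), whose integral is o(side^2). *)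
Lemma goursat F a b c d : a <= b -> c <= d -> continuous F ->
  (forall z, inR a b c d z -> derivable F z 1) -> rint F a b c d = 0.
Proof.
move=> ab cd cF dF.
pose W := b - a; pose H := d - c; pose L := W + H.
have W0 : 0 <= W by rewrite subr_ge0.
have H0 : 0 <= H by rewrite subr_ge0.
(* A rectangle similar to the given one is coded by its lower left corner [p] and its scale [s]. *)
pose sq (p : R * R) s := rint F p.1 (p.1 + s * W) p.2 (p.2 + s * H).
(* The sign condition sits under the existential, so that [choice] yields a total function of the
   rectangle. *)
have step (q : (R * R) * R) : exists p : R * R,
    0 <= q.2 -> [/\ q.1.1 <= p.1 <= q.1.1 + q.2 / 2 * W,
      q.1.2 <= p.2 <= q.1.2 + q.2 / 2 * H & nm (sq q.1 q.2) <= 4 * nm (sq p (q.2 / 2))].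
  case: q => -[x y] s /=.
  have [s0|s0] := leP 0 s; last by exists (0, 0) => h; exfalso; lra.
  pose x' := x + s / 2 * W; pose y' := y + s / 2 * H.
  have ex : x' + s / 2 * W = x + s * W by rewrite /x'; field.
  have ey : y' + s / 2 * H = y + s * H by rewrite /y'; field.
  have E : sq (x, y) s = (sq (x, y) (s / 2) + sq (x, y') (s / 2)) +
                         (sq (x', y) (s / 2) + sq (x', y') (s / 2)).
    rewrite /sq /= ex ey (rint_splitv F x').
    by rewrite (rint_splith F y' x) (rint_splith F y' x').
  have sW : 0 <= s / 2 * W by rewrite mulr_ge0// divr_ge0.
  have sH : 0 <= s / 2 * H by rewrite mulr_ge0// divr_ge0.
  have T : nm (sq (x, y) s) <= (nm (sq (x, y) (s / 2)) + nm (sq (x, y') (s / 2))) +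
                         (nm (sq (x', y) (s / 2)) + nm (sq (x', y') (s / 2))).
    by rewrite E (le_trans (nmD _ _))// lerD// nmD.
  have [h1|h1] := leP (nm (sq (x, y) s)) (4 * nm (sq (x, y) (s / 2))).
    by exists (x, y) => _; rewrite /= !lexx !lerDl sW sH.
  have [h2|h2] := leP (nm (sq (x, y) s)) (4 * nm (sq (x, y') (s / 2))).
    by exists (x, y') => _; rewrite /= !lexx !lerDl sW sH.
  have [h3|h3] := leP (nm (sq (x, y) s)) (4 * nm (sq (x', y) (s / 2))).
    by exists (x', y) => _; rewrite /= !lexx !lerDl sW sH.
  (* If the first three quarters each carry less than a quarter of the integral, [T] forces the last
     one to carry more. *)
  exists (x', y') => _; rewrite /= !lexx !lerDl sW sH; split=> //; lra.
have [st stP] := choice step.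
pose s n : R := 2^-1 ^+ n.
have s0 n : 0 <= s n by rewrite exprn_ge0// invr_ge0.
have sS n : s n.+1 = s n / 2 by rewrite /s exprSr.
pose P := fix P n := if n is m.+1 then st (P m, s m) else (a, c).
have PS n := stP (P n, s n) (s0 n).
have [X XP] : exists X, forall n, (P n).1 <= X <= (P n).1 + s n * W.
  apply: (@nested_intervals (fun n => (P n).1) (fun n => s n * W)) => n.
  - by rewrite mulr_ge0.
  - by have [/andP[]] := PS n.
  - by have [/andP[_ h] _ _] := PS n; rewrite sS; move: h; rewrite /=; lra.
have [Y YP] : exists Y, forall n, (P n).2 <= Y <= (P n).2 + s n * H.
  apply: (@nested_intervals (fun n => (P n).2) (fun n => s n * H)) => n.
  - by rewrite mulr_ge0.
  - by have [_ /andP[]] := PS n.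
  - by have [_ /andP[_ h] _] := PS n; rewrite sS; move: h; rewrite /=; lra.
have big n : nm (sq (a, c) 1) <= 4 ^+ n * nm (sq (P n) (s n)).
  elim: n => [|n IH]; first by rewrite expr0 mul1r /s expr0.
  have [_ _ h] := PS n; rewrite sS exprSr -mulrA (le_trans IH)//.
  by rewrite ler_pM2l// exprn_gt0.
have sq1 : sq (a, c) 1 = rint F a b c d.
  by rewrite /sq /= !mul1r /W /H !subrKC.
apply/eqP; rewrite -nm_eq0 -sq1; set eta := nm _.
apply: contraT => eta0'.
have eta0 : 0 < eta by rewrite lt_neqAle eq_sym eta0' nm_ge0.
pose z0 := mkC X Y.
have [D HD] : exists D : C, forall e : R, 0 < e -> exists2 d : R, 0 < d &
    forall y : C, nm (y - z0) < d -> nm (F y - F z0 - D * (y - z0)) <= e * nm (y - z0).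
  apply/derivableC/dF; have := XP 0; have := YP 0.
  by rewrite /inR /= /s expr0 !mul1r /W /H !subrKC => -> ->.
have L0 : 0 <= L by rewrite addr_ge0.
(* The final estimate is [8 * e * L ^+ 2], which this choice keeps below [eta]; the added 1 covers
   the degenerate case [L = 0]. *)
pose e := eta / (16 * (L ^+ 2 + 1)).
have L21 : 0 < L ^+ 2 + 1 by rewrite ltr_wpDl// exprn_ge0.
have e0 : 0 < e by rewrite divr_gt0// mulr_gt0.
have [dl dl0 dlP] := HD e e0.
have [n nP] : exists n, s n * L < dl.
  pose n := (Num.truncn (L / dl)).+1; exists n.
  have h1 : L / dl < n%:R by exact: truncnS_gt.
  have h2 : n%:R <= (2 : R) ^+ n by rewrite -natrX ler_nat ltnW// ltn_expl.
  rewrite /s exprVn mulrC ltr_pdivrMr ?exprn_gt0//.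
  by move: h1; rewrite ltr_pdivrMr// => h1; rewrite (lt_le_trans h1)// mulrC ler_pM2l.
(* On the [n]-th rectangle both the sides and the distance to [z0] are at most [s n * L], so the
   affine error is at most [e * (s n * L)]. *)
have bound : nm (sq (P n) (s n)) <= 8 * (e * (s n * L)) * (s n * L).
  have [okG] := rint_sub_affine D (F z0 - D * z0) (P n).1 ((P n).1 + s n * W)
    (P n).2 ((P n).2 + s n * H) cF.
  rewrite -/(sq (P n) (s n)) => ->.
  have sW : 0 <= s n * W by rewrite mulr_ge0.
  have sH : 0 <= s n * H by rewrite mulr_ge0.
  have sL : s n * L = s n * W + s n * H by rewrite mulrDr.
  apply: (rint_bound _ _ _ _ okG); rewrite ?lerDl//.
  - by rewrite addrC addKr sL lerDl.
  - by rewrite addrC addKr sL lerDr.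
  move=> z /andP[zR _].
  have zz0 : nm (z - z0) <= s n * L.
    rewrite (le_trans (nm_le_ReIm _))// !CE /= sL.
    have := XP n; have := YP n; move: zR; rewrite /inR.
    move=> /andP[/andP[? ?] /andP[? ?]] /andP[? ?] /andP[? ?].
    by apply: lerD; rewrite ler_norml; apply/andP; split; lra.
  rewrite (_ : F z - _ = F z - F z0 - D * (z - z0)); last by ring.
  rewrite (le_trans (dlP _ (le_lt_trans zz0 nP)))// ler_wpM2l//; exact: ltW.
have key : eta <= 8 * e * L ^+ 2.
  apply: le_trans (big n) _.
  rewrite -/(s n); apply: le_trans (ler_wpM2l _ bound) _; first by rewrite exprn_ge0.
  (* The factor [4 ^+ n] lost in [n] bisections is exactly compensated by the squared scale. *)
  rewrite (_ : 4 ^+ n * _ = (4 ^+ n * (s n) ^+ 2) * (8 * e * L ^+ 2)); last by ring.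
  rewrite (_ : 4 ^+ n * _ = 1) ?mul1r//.
  rewrite /s -exprM mulnC exprM -exprMn (_ : 4 * _ = 1) ?expr1n//; by field.
have : 8 * e * L ^+ 2 < eta.
  rewrite /e (_ : 8 * _ * _ = eta * (L ^+ 2 / (2 * (L ^+ 2 + 1)))); last by field; lra.
  rewrite -[X in _ < X]mulr1 ltr_pM2l// ltr_pdivrMr ?mulr_gt0//; lra.
by rewrite ltNge key.
Qed.

End Goursat.

(** * Goursat's lemma with exceptional points *)

Section Cauchy.
Variable R : realType.
Local Notation C := (Cx R).
Implicit Types (F u : C -> C) (a b c d : R).

(* Only the rectangle of half-width e around p can contribute to the integral, and
   this contribution is O(e). *)
Lemma rint_exceptional_point F (p : C) a b c d : a <= b -> c <= d ->
  continuous F ->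
  (forall a' b' c' d', a <= a' -> a' <= b' -> b' <= b -> c <= c' -> c' <= d' -> d' <= d ->
    ~~ inR a' b' c' d' p -> rint F a' b' c' d' = 0) ->
  rint F a b c d = 0.
Proof.
move=> ab cd cF H.
case: (boolP (inR a b c d p)) => [|]; last exact: H.
move=> /andP[/andP[ap pb] /andP[cp pd]].
apply/eqP; rewrite -nm_eq0; apply: contraT => eta0'.
have eta0 : 0 < nm (rint F a b c d) by rewrite lt_neqAle eq_sym eta0' nm_ge0.
have [dl dl0 dlP] := (contC F p).1 (cF p) 1 ltr01.
pose M := nm (F p) + 1.
have M0 : 0 < M by rewrite ltr_wpDl// nm_ge0.
(* The first bound gives [2 * e < dl], so that [M] bounds [F] on the small rectangle; the second
   makes the contribution [16 * M * e] smaller than the supposedly nonzero integral. *)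
pose e := Num.min (dl / 3) (nm (rint F a b c d) / (32 * M)).
have e0 : 0 < e by rewrite lt_min !divr_gt0// mulr_gt0.
have edl : e <= dl / 3 by rewrite ge_min lexx.
have eeta : e * (32 * M) <= nm (rint F a b c d).
  by rewrite -ler_pdivlMr ?mulr_gt0// ge_min lexx orbT.
(* The square around [p] is cut by the given rectangle, as [p] may lie on or near its boundary. *)
pose a1 := Num.max a (re p - e); pose b1 := Num.min b (re p + e).
pose c1 := Num.max c (im p - e); pose d1 := Num.min d (im p + e).
have aa1 : a <= a1 by rewrite le_max lexx.
have b1b : b1 <= b by rewrite ge_min lexx.
have cc1 : c <= c1 by rewrite le_max lexx.
have d1d : d1 <= d by rewrite ge_min lexx.
have a1p : a1 <= re p by rewrite ge_max ap/= gerBl ltW.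
have pb1 : re p <= b1 by rewrite le_min pb/= lerDl ltW.
have c1p : c1 <= im p by rewrite ge_max cp/= gerBl ltW.
have pd1 : im p <= d1 by rewrite le_min pd/= lerDl ltW.
have a1b1 := le_trans a1p pb1; have c1d1 := le_trans c1p pd1.
have a1e : re p - e <= a1 by rewrite le_max lexx orbT.
have b1e : b1 <= re p + e by rewrite ge_min lexx orbT.
have c1e : im p - e <= c1 by rewrite le_max lexx orbT.
have d1e : d1 <= im p + e by rewrite ge_min lexx orbT.
(* Each of the four strips left over is degenerate or misses [p], so its integral vanishes. *)
have l1 : rint F a a1 c d = 0.
  have [E|E] := eqVneq a1 a; first by rewrite E rint_degv.
  apply: H => //; first exact: le_trans pb.
  rewrite /inR; suff -> : (re p <= a1) = false by rewrite andbF.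
  apply/negbTE; rewrite -ltNge; move: E; rewrite /a1.
  by case: (leP a (re p - e)) => [_ _|_]; [lra|rewrite eqxx].
have l2 : rint F b1 b c d = 0.
  have [E|E] := eqVneq b1 b; first by rewrite E rint_degv.
  apply: H => //; first exact: le_trans pb1.
  rewrite /inR; suff -> : (b1 <= re p) = false by [].
  apply/negbTE; rewrite -ltNge; move: E; rewrite /b1.
  by case: (leP b (re p + e)) => [_|_ _]; [rewrite eqxx|lra].
have l3 : rint F a1 b1 c c1 = 0.
  have [E|E] := eqVneq c1 c; first by rewrite E rint_degh.
  apply: H => //; first exact: le_trans pd.
  rewrite /inR; suff -> : (im p <= c1) = false by rewrite !andbF.
  apply/negbTE; rewrite -ltNge; move: E; rewrite /c1.
  by case: (leP c (im p - e)) => [_ _|_]; [lra|rewrite eqxx].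
have l4 : rint F a1 b1 d1 d = 0.
  have [E|E] := eqVneq d1 d; first by rewrite E rint_degh.
  apply: H => //; first exact: le_trans pd1.
  rewrite /inR; suff -> : (d1 <= im p) = false by rewrite andbF.
  apply/negbTE; rewrite -ltNge; move: E; rewrite /d1.
  by case: (leP d (im p + e)) => [_|_ _]; [rewrite eqxx|lra].
have E : rint F a b c d = rint F a1 b1 c1 d1.
  rewrite (rint_splitv F a1) l1 add0r (rint_splitv F b1) l2 addr0.
  by rewrite (rint_splith F c1) l3 add0r (rint_splith F d1) l4 addr0.
have : nm (rint F a1 b1 c1 d1) <= 8 * M * (2 * e).
  apply: rint_bound => //; [lra|lra|exact: okb_cont|].
  move=> z /andP[/andP[/andP[? ?] /andP[? ?]] _].
  have zp : nm (z - p) < dl.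
    apply: le_lt_trans (nm_le_ReIm _) _; rewrite !CE.
    have h1 : `|re z - re p| <= e by rewrite ler_norml; apply/andP; split; lra.
    have h2 : `|im z - im p| <= e by rewrite ler_norml; apply/andP; split; lra.
    lra.
  have := dlP _ zp; have := nmD (F z - F p) (F p); rewrite subrK /M; lra.
rewrite -E => h; suff : nm (rint F a b c d) < nm (rint F a b c d) by rewrite ltxx.
apply: le_lt_trans h _; apply: lt_le_trans eeta.
rewrite (_ : e * _ = 8 * M * (2 * e) + 8 * M * (2 * e)); last by ring.
by rewrite ltrDl !mulr_gt0.
Qed.

(** Removing [p] and then [q] leaves rectangles avoiding both. Below, one point is the origin, where
    [u] is only continuous, and the other is the point [w] at which a difference quotient is
    formed. *)
Lemma goursat_two_points F (p q : C) a b c d : a <= b -> c <= d -> continuous F ->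
  (forall z, inR a b c d z -> z != p -> z != q -> derivable F z 1) ->
  rint F a b c d = 0.
Proof.
move=> ab cd cF dF.
apply: (@rint_exceptional_point F p) => // a1 b1 c1 d1 aa1 ab1 b1b cc1 cd1 d1d p1.
apply: (@rint_exceptional_point F q) => // a2 b2 c2 d2 aa2 ab2 b2b cc2 cd2 d2d q2.
apply: goursat => // z zR; apply: dF.
- move: zR => /andP[/andP[? ?] /andP[? ?]]; apply/andP.
  by split; apply/andP; split; lra.
- apply: contraNneq p1 => <-.
  move: zR => /andP[/andP[? ?] /andP[? ?]]; apply/andP.
  by split; apply/andP; split; lra.
- by apply: contraNneq q2 => <-.
Qed.

End Cauchy.

(** * Cauchy's formula on a square *)

Section CauchySquare.
Variable R : realType.
Local Notation C := (Cx R).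
Implicit Types (F u : C -> C) (w z : C).

Definition half : R := 2^-1.
Definition Qint F : C := rint F (- half) half (- half) half.
Definition Qline z := bline (- half) half (- half) half z.

(** This is a continuous isolated singularity, normalized to sit at the origin. Continuity is global
    because contour integrals involve whole lines; the domain of derivability contains the square of
    integration in its interior. *)
Definition admissible u := continuous u /\
  forall z, `|re z| < 1 -> `|im z| < 1 -> z != 0 -> derivable u z 1.

Lemma half_gt0 : 0 < half. Proof. by rewrite invr_gt0. Qed.
Lemma half_lt1 : half < 1. Proof. by rewrite invf_lt1 ?ltr1n. Qed.

Lemma Qline_nm z : Qline z -> half <= nm z.
Proof.
have h0 := half_gt0.
move=> /or4P[] /eqP E.
- by apply: le_trans (Re_le_nm z); rewrite E normrN ger0_norm// ltW.
- by apply: le_trans (Re_le_nm z); rewrite E ger0_norm// ltW.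
- by apply: le_trans (Im_le_nm z); rewrite E normrN ger0_norm// ltW.
- by apply: le_trans (Im_le_nm z); rewrite E ger0_norm// ltW.
Qed.

Lemma Qline_sub z w : Qline z -> nm w < half / 2 -> half / 2 <= nm (z - w).
Proof.
move=> /Qline_nm h1 h2; have := nmD (z - w) w; rewrite subrK; lra.
Qed.

Lemma Qline_neq z w : Qline z -> nm w < half / 2 -> z - w != 0.
Proof.
move=> zQ h; rewrite -nm_gt0; apply: lt_le_trans (Qline_sub zQ h).
by rewrite divr_gt0// half_gt0.
Qed.

Lemma nm_center : nm (0 : C) < half / 2.
Proof. by rewrite nm0 divr_gt0// half_gt0. Qed.

Lemma Qline_neq0 z : Qline z -> z != 0.
Proof. by move=> zQ; have := Qline_neq zQ nm_center; rewrite subr0. Qed.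

Lemma Qint_bound F M : okb F (- half) half (- half) half ->
  (forall z, Qline z -> nm (F z) <= M) -> nm (Qint F) <= 8 * M.
Proof.
move=> okF FM; rewrite -[8 * M]mulr1.
have h0 := half_gt0.
have e1 : half - - half = 1 by rewrite /half; field.
by apply: rint_bound => //; [lra|lra|rewrite e1|rewrite e1|move=> z /andP[_ /FM]].
Qed.

Lemma continuous_mulC F G z : {for z, continuous F} -> {for z, continuous G} ->
  {for z, continuous (fun z => F z * G z)}.
Proof. move=> cF cG; exact: (@continuousM _ _ F G z cF cG). Qed.

Lemma derivable_inv_sub w z : z - w != 0 -> derivable (fun z => (z - w)^-1) z 1.
Proof.
by move=> h; apply: derC_inv.
Qed.

(* Cauchy's integral without the factor 1/(2 pi i), which is replaced below by the
   inverse of the integral for the constant 1; only its nonvanishing is needed. *)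
Definition cauchy_int u w := Qint (fun z => u z * (z - w)^-1).

Lemma okb_cauchy u w : continuous u -> nm w < half / 2 ->
  okb (fun z => u z * (z - w)^-1) (- half) half (- half) half.
Proof.
move=> cu hw; apply: okb_bline => z zQ; apply: continuous_mulC; first exact: cu.
by apply/derivable_contC/derivable_inv_sub; exact: Qline_neq hw.
Qed.

(** The difference quotient of [u] at [w], with [D] meant to be the derivative there. *)
Definition slope u (D w z : C) := if z == w then D else (u z - u w) * (z - w)^-1.

Lemma slope_near u D w z : z != w ->
  \forall y \near z, (u y - u w) * (y - w)^-1 = slope u D w y.
Proof.
move=> zw; apply/nearC; exists (nm (z - w)); first by rewrite nm_gt0 subr_eq0.
move=> y yz; rewrite /slope; case: eqP => // E.
by move: yz; rewrite E nm_distC ltxx.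
Qed.

Lemma slope_derivable u D w z : z != w -> derivable u z 1 -> derivable (slope u D w) z 1.
Proof.
move=> zw du; apply: derC_ext (slope_near u D zw) _.
apply: derC_mul; last by apply: derivable_inv_sub; rewrite subr_eq0.
exact: (derC_sub du (derC_cst (u w) z)).
Qed.

(** Continuity at [w] is the definition of the derivative [D]; elsewhere the slope agrees locally
    with a product of continuous functions. *)
Lemma slope_continuous u w : continuous u -> derivable u w 1 ->
  exists D, continuous (slope u D w).
Proof.
move=> cu /derivableC[D DP]; exists D => z.
have [->|zw] := eqVneq z w.
  apply/contC => e e0.
  have [d d0 dP] := DP (e / 2) (divr_gt0 e0 (ltr0n _ 2)).
  exists d => // y /dP; rewrite {2}/slope eqxx /slope.
  case: eqVneq => [_|yw]; first by rewrite subrr nm0.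
  have yw0 : y - w != 0 by rewrite subr_eq0.
  rewrite nm_quotient// ler_pM2r ?nm_gt0// => h.
  by rewrite nm_distC [_ * _^-1]mulrC (le_lt_trans h)//; lra.
have c1 : {for z, continuous (fun y => (u y - u w) * (y - w)^-1)}.
  apply: continuous_mulC; last first.
    by apply/derivable_contC/derivable_inv_sub; rewrite subr_eq0.
  apply/contC => e e0; have [d d0 dP] := (contC u z).1 (cu z) e e0.
  by exists d => // y /dP; rewrite opprB addrA subrK.
apply/contC => e e0; have [d d0 dP] := (contC _ z).1 c1 e e0.
have /nearC[d' d'0 d'P] := slope_near u D zw.
exists (Num.min d d') => [|y]; first by rewrite lt_min d0.
rewrite lt_min => /andP[/dP h /d'P <-].
by rewrite -(d'P z)// subrr nm0.
Qed.

Lemma Q_interior z : inR (- half) half (- half) half z -> `|re z| < 1 /\ `|im z| < 1.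
Proof.
have := half_lt1.
by move=> ? /andP[/andP[? ?] /andP[? ?]]; rewrite !ltr_norml; split; apply/andP; split; lra.
Qed.

Lemma nm_small_in w : nm w < half / 2 -> `|re w| < 1 /\ `|im w| < 1.
Proof.
have := half_lt1; have := half_gt0; have := Re_le_nm w; have := Im_le_nm w.
by move=> *; split; lra.
Qed.

(** The slope at [w] has integral 0 by [goursat_two_points], and on the contour it equals
    [(u z - u w) / (z - w)]. The condition [w != 0] provides the derivative of [u] at [w]. *)
Lemma cauchy_formula u w : admissible u -> w != 0 -> nm w < half / 2 ->
  u w * cauchy_int (fun=> 1) w = cauchy_int u w.
Proof.
move=> [cu du] w0 hw.
have [w1 w2] := nm_small_in hw.
have [D cD] := slope_continuous cu (du w w1 w2 w0).
have K0 : Qint (slope u D w) = 0.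
  have h0 := half_gt0.
  apply: (@goursat_two_points _ _ 0 w) => //; [lra|lra|].
  move=> z /Q_interior[z1 z2] z0 zw; apply: slope_derivable => //; exact: du.
have c1 : continuous (fun _ : C => 1 : C) by move=> y; apply: derivable_contC; exact: derC_cst.
have ok1 := okb_cauchy c1 hw.
have okS := okb_cont (- half) half (- half) half cD.
have := rint_lin (u w) ok1 okS; rewrite -/(Qint (slope u D w)) K0 addr0.
rewrite /cauchy_int /Qint => <-.
apply: rint_ext => z zQ; rewrite /slope.
have := Qline_neq zQ hw; rewrite subr_eq0 => /negbTE ->.
by rewrite mul1r mulrBl addrC subrK.
Qed.

(** Integrating [1/(z - w) = 1/z + w/z^2 + w^2/(z^2 (z - w))] against [u] gives the derivative
    [Qint q] and a remainder of order [w ^+ 2]. *)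
Lemma cauchy_int_derivable u M : continuous u ->
  (forall z, Qline z -> nm (u z) <= M) -> derivable (cauchy_int u) 0 1.
Proof.
move=> cu uM.
have h0 := half_gt0.
have M0 : 0 <= M.
  apply: le_trans (uM (mkC half 0) _); first exact: nm_ge0.
  by rewrite /Qline /bline /= eqxx orbT.
pose q z : C := u z * (z - 0)^-1 * (z - 0)^-1.
have c0 z : Qline z -> {for z, continuous (fun z => (z - 0)^-1)}.
  by move=> zQ; apply/derivable_contC/derivable_inv_sub; exact: Qline_neq nm_center.
have okq : okb q (- half) half (- half) half.
  apply: okb_bline => z zQ; apply: continuous_mulC; last exact: c0.
  by apply: continuous_mulC; [exact: cu|exact: c0].
apply/derivableC; exists (Qint q) => e e0.
(* The bound [half / 2] keeps [w] at distance at least 1/4 from the contour, where the remainder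
   integral is at most [8 * (M * 2 * 2 * 4) = 128 * M]. *)
pose d := Num.min (half / 2) (e / (128 * M + 1)).
have M1 : 0 < 128 * M + 1 by rewrite ltr_wpDl// mulr_ge0.
exists d; first by rewrite lt_min !divr_gt0.
move=> w; rewrite !subr0 lt_min => /andP[hw we].
pose r z : C := q z * (z - w)^-1.
have okr : okb r (- half) half (- half) half.
  apply: okb_bline => z zQ; apply: continuous_mulC.
    apply: continuous_mulC; last exact: c0.
    by apply: continuous_mulC; [exact: cu|exact: c0].
  by apply/derivable_contC/derivable_inv_sub; exact: Qline_neq hw.
have ok0 := okb_cauchy cu nm_center.
have okq0 := okb_lin w okq ok0.
have E : cauchy_int u w = w ^+ 2 * Qint r + (w * Qint q + cauchy_int u 0).
  rewrite /cauchy_int /Qint -(rint_lin _ okq ok0) -(rint_lin _ okr okq0).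
  apply: rint_ext => z zQ; rewrite /r /q.
  have := Qline_neq zQ hw; have := Qline_neq0 zQ; rewrite subr0 => z0 zw.
  by field; rewrite z0.
rewrite E (_ : _ - _ = w ^+ 2 * Qint r); last by ring.
have rM : nm (Qint r) <= 8 * (M * 2 * 2 * 4).
  apply: Qint_bound okr _ => z zQ; rewrite /r /q subr0 !nmM !nmV.
  have z1 : (nm z)^-1 <= 2.
    rewrite -[2]invrK lef_pV2 ?posrE ?invr_gt0//; first exact: Qline_nm.
    exact: lt_le_trans (Qline_nm zQ).
  have z2 : (nm (z - w))^-1 <= 4.
    have := Qline_sub zQ hw => h.
    rewrite -[4]invrK lef_pV2 ?posrE ?invr_gt0//.
      by apply: le_trans h; rewrite /half; lra.
    by apply: lt_le_trans h; rewrite divr_gt0.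
  by do 3 (apply: ler_pM => //; rewrite ?mulr_ge0 ?nm_ge0 ?invr_ge0 ?nm_ge0//); exact: uM.
rewrite nmM nmX expr2 -mulrA [X in _ <= X]mulrC ler_wpM2l ?nm_ge0//.
have := nm_ge0 w => w0.
apply: le_trans (_ : nm w * (128 * M + 1) <= e).
  rewrite ler_wpM2l//; lra.
by rewrite -ler_pdivlMr// ltW.
Qed.

End CauchySquare.
Arguments slope_derivable {R u} D {w z} _ _.
Arguments half {R}.

(** * Removable singularities and factorization at the origin *)

Section LocalFactorization.
Variable R : realType.
Local Notation C := (Cx R).
Implicit Types (F u v : C -> C) (w z : C).
Local Notation winding := (cauchy_int (fun _ : C => 1 : C)).

Lemma ReV z : re z^-1 = re z / (re z ^+ 2 + im z ^+ 2).
Proof. by case: z. Qed.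
Lemma ImV z : im z^-1 = - im z / (re z ^+ 2 + im z ^+ 2).
Proof. by case: z => a b; rewrite mulNr. Qed.

(** Up to sign, the quotient is the component of [1/z] that enters the imaginary part of the
    integral of [dz/z] along a side of the square. *)
Lemma side_bounds (t : R) : - half <= t <= half -> 1 <= half / (half ^+ 2 + t ^+ 2) <= 2.
Proof.
move=> /andP[h1 h2]; have h0 := half_gt0 R.
have t2 : t ^+ 2 <= half ^+ 2.
  by rewrite -(real_normK (num_real t)) lerXn2r ?nnegrE ?(ltW h0)// ler_norml h1.
have p : 0 < half ^+ 2 + t ^+ 2 by rewrite ltr_pwDl ?exprn_gt0 ?sqr_ge0.
have h4 : (half : R) ^+ 2 = 4^-1 by rewrite /half; field.
have e1 : (half : R) = 2^-1 by [].
rewrite ler_pdivlMr// ler_pdivrMr//; have := sqr_ge0 t; rewrite h4 in t2 *; rewrite e1.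
by move=> ?; apply/andP; split; lra.
Qed.

(** Each of the four sides contributes at least 1 to the imaginary part, so the exact value is never
    computed. *)
Lemma winding_neq0 : winding 0 != 0.
Proof.
have c1 : continuous (fun _ : C => 1 : C).
  by move=> y; apply: derivable_contC; exact: derC_cst.
have [[_ h1] [_ h2] [h3 _] [h4 _]] := okb_cauchy c1 (nm_center R).
have hh : - half <= half :> R by have := half_gt0 R; lra.
have e1 : half - - half = 1 :> R by rewrite /half; field.
have B1 := @integ_between _ _ (- half) half 1 2 hh h1.
have B2 := @integ_between _ _ (- half) half (-2) (-1) hh h2.
have B3 := @integ_between _ _ (- half) half (-2) (-1) hh h3.
have B4 := @integ_between _ _ (- half) half 1 2 hh h4.
rewrite e1 !mulr1 in B1 B2 B3 B4.
have {}B1 := B1 _; have {}B2 := B2 _; have {}B3 := B3 _; have {}B4 := B4 _.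
suff : 0 < im (winding 0) by apply: contraTneq => ->; rewrite CE ltxx.
rewrite /cauchy_int /Qint /rint /cinteg !CE !mul0r add0r mul1r.
have /andP[b1 _] : 1 <= integ (fun t : R => im (1 * (mkC t (- half) - 0)^-1)) (- half) half <= 2.
  apply: B1 => t /side_bounds; rewrite mul1r subr0 ImV /= opprK sqrrN addrC.
  by rewrite [t ^+ 2 + _]addrC.
have /andP[_ b2] : -2 <= integ (fun t : R => im (1 * (mkC t half - 0)^-1)) (- half) half <= -1.
  apply: B2 => t /side_bounds; rewrite mul1r subr0 ImV /= [t ^+ 2 + _]addrC mulNr.
  by move=> /andP[? ?]; apply/andP; split; lra.
have /andP[_ b3] : -2 <= integ (fun t : R => re (1 * (mkC (- half) t - 0)^-1)) (- half) half <= -1.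
  apply: B3 => t /side_bounds; rewrite mul1r subr0 ReV /= sqrrN mulNr.
  by move=> /andP[? ?]; apply/andP; split; lra.
have /andP[b4 _] : 1 <= integ (fun t : R => re (1 * (mkC half t - 0)^-1)) (- half) half <= 2.
  by apply: B4 => t /side_bounds; rewrite mul1r subr0 ReV.
lra.
Qed.

Lemma winding_derivable : derivable (winding) 0 1.
Proof.
apply: (@cauchy_int_derivable _ _ 1) => [y|z _]; last by rewrite nm1.
by apply: derivable_contC; exact: derC_cst.
Qed.

Lemma continuous_eq_at F G z : {for z, continuous F} -> {for z, continuous G} ->
  (\forall y \near z^', F y = G y) -> F z = G z.
Proof.
move=> /contC cF /contC cG /dnearC[d d0 FG].
apply/eqP; rewrite -subr_eq0 -nm_eq0; apply: contraT => n0.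
pose e := nm (F z - G z).
have e0 : 0 < e by rewrite lt_neqAle eq_sym n0 nm_ge0.
have [d1 d10 P1] := cF (e / 2) (divr_gt0 e0 (ltr0n _ 2)).
have [d2 d20 P2] := cG (e / 2) (divr_gt0 e0 (ltr0n _ 2)).
pose m := Num.min d (Num.min d1 d2).
have m0 : 0 < m by rewrite !lt_min d0 d10 d20.
pose y := z + mkC (m / 2) 0.
have yz : nm (y - z) = m / 2 by rewrite /y addrC addKr nm_real ger0_norm// divr_ge0// ltW.
have ym : nm (y - z) < m by rewrite yz; lra.
have y0 : y != z by rewrite -subr_eq0 -nm_gt0 yz divr_gt0.
have [yd [yd1 yd2]] : nm (y - z) < d /\ nm (y - z) < d1 /\ nm (y - z) < d2.
  by move: ym; rewrite !lt_min => /and3P[].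
have := P1 _ yd1; have := P2 _ yd2; rewrite (FG _ y0 yd) => a b.
have := nmB (G y - G z) (G y - F z).
rewrite (_ : _ - _ = F z - G z); last by ring.
by rewrite -/e; lra.
Qed.

(** Cauchy's formula makes [u] equal to [cauchy_int u w / winding w] near 0 but off 0, and
    continuity extends this to 0. The quotient is derivable at 0. *)
Lemma removable_singularity u : admissible u ->
  (exists M, forall z, Qline z -> nm (u z) <= M) -> derivable u 0 1.
Proof.
move=> au [M uM].
have dA := cauchy_int_derivable au.1 uM.
pose q w := cauchy_int u w * (winding w)^-1.
have dq : derivable q 0 1.
  by apply: derC_mul dA _; apply: derC_inv winding_neq0 winding_derivable.
have [d d0 dP] : exists2 d : R, 0 < d & forall w, nm w < d -> winding w != 0.
  have cW := derivable_contC winding_derivable.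
  have n0 : 0 < nm (winding 0) by rewrite nm_gt0 winding_neq0.
  have [d d0 dP] := (contC _ _).1 cW _ n0.
  exists d => // w wd; have := dP w; rewrite subr0 => /(_ wd).
  by apply: contraTneq => ->; rewrite sub0r nmN ltxx.
have eq : \forall y \near (0 : C)^', q y = u y.
  apply/dnearC; exists (Num.min d (half / 2)).
    by rewrite lt_min d0 divr_gt0// half_gt0.
  move=> w w0; rewrite subr0 lt_min => /andP[wd wh].
  by rewrite /q -(cauchy_formula au w0 wh) mulfK// dP.
have e0 : q 0 = u 0.
  apply: continuous_eq_at eq; last exact: au.1.
  exact: derivable_contC dq.
apply: derC_ext dq; apply/nearC.
move: eq => /dnearC[d' d'0 d'P]; exists d' => // y yd.
by have [->//|y0] := eqVneq y 0; exact: d'P.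
Qed.

(* K and d do not depend on u: applied to all the quotients v(z)/z^k, this bounds the
   order of vanishing of v. *)
Lemma cauchy_estimate : exists K d : R, [/\ 0 < d, d <= half / 2 & forall u M w,
  admissible u -> (forall z, Qline z -> nm (u z) <= M) ->
  w != 0 -> nm w < d -> nm (u w) <= K * M].
Proof.
have n0 : 0 < nm (winding 0) by rewrite nm_gt0 winding_neq0.
have n2 : 0 < nm (winding 0) / 2 by rewrite divr_gt0.
have [d d0 dP] := (contC _ _).1 (derivable_contC winding_derivable) _ n2.
have h0 := half_gt0 R.
(* Here 32 is 8 from [Qint_bound] times 4, the bound for [1/(z - w)]; [d] keeps the winding integral
   above half its modulus at 0. *)
exists (32 / (nm (winding 0) / 2)), (Num.min d (half / 2)).
split; first by rewrite lt_min d0 divr_gt0.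
  by rewrite ge_min lexx orbT.
move=> u M w au uM w0; rewrite lt_min => /andP[wd wh].
have Nw : nm (winding 0) / 2 <= nm (winding w).
  have := dP w; rewrite subr0 => /(_ wd) => h.
  have := nmB (winding w) (winding w - winding 0).
  by rewrite opprB addrCA subrr addr0; lra.
have uw : nm (u w) * nm (winding w) <= 8 * (M * 4).
  rewrite -nmM cauchy_formula//; apply: Qint_bound; first exact: okb_cauchy au.1 wh.
  move=> z zQ; rewrite nmM nmV; apply: ler_pM; rewrite ?nm_ge0 ?invr_ge0 ?nm_ge0//.
    exact: uM.
  have h := Qline_sub zQ wh.
  rewrite -[4]invrK lef_pV2 ?posrE ?invr_gt0//.
    by apply: le_trans h; rewrite /half; lra.
  by apply: lt_le_trans h; rewrite divr_gt0.
rewrite mulrAC ler_pdivlMr//.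
apply: le_trans (_ : nm (u w) * nm (winding w) <= _).
  by rewrite ler_wpM2l ?nm_ge0.
by apply: le_trans uw _; lra.
Qed.

(** The quotient is the slope at 0, continuous because [u] is derivable there. It is again
    admissible since derivability is only required off 0. *)
Lemma divide_zero u : admissible u -> derivable u 0 1 -> u 0 = 0 ->
  exists b, admissible b /\ forall z, u z = z * b z.
Proof.
move=> [cu du] d0 u0.
have [D cD] := slope_continuous cu d0.
exists (slope u D 0); split.
  split; first exact: cD.
  by move=> z z1 z2 z0; exact (slope_derivable D z0 (du z z1 z2 z0)).
move=> z; rewrite /slope; case: eqVneq => [->|z0]; first by rewrite u0 mul0r.
by rewrite u0 !subr0 mulrC mulfVK.
Qed.

(** Factors [z] are split off while the quotient vanishes at 0. After [k] divisions
    [cauchy_estimate] bounds [v] at a fixed point by a multiple of [4 ^- k], so a nonzero value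
    there forces a stop. *)
Lemma zero_factorization v M : admissible v -> (forall z, nm (v z) <= M) ->
  (forall z, `|re z| < 1 -> `|im z| < 1 -> z != 0 -> v z != 0) ->
  exists k b, [/\ admissible b, derivable b 0 1, b 0 != 0 & forall z, v z = z ^+ k * b z].
Proof.
move=> av vM v0.
(* On the contour the modulus of [z] is at least 1/2, so each division costs at most a factor 2. *)
have rem k b : admissible b -> (forall z, v z = z ^+ k * b z) ->
    forall z, Qline z -> nm (b z) <= M * 2 ^+ k.
  move=> ab vb z zQ; have z0 := Qline_neq0 zQ.
  have nz : 0 < nm z by rewrite nm_gt0.
  have -> : b z = v z * (z^-1) ^+ k.
    by rewrite vb mulrC exprVn mulKf// expf_neq0.
  rewrite nmM nmX nmV; apply: ler_pM; rewrite ?exprn_ge0 ?invr_ge0 ?nm_ge0//.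
  apply: lerXn2r; rewrite ?nnegrE ?invr_ge0 ?nm_ge0//.
  by rewrite -[2]invrK lef_pV2 ?posrE ?invr_gt0//; exact: Qline_nm.
have step k : (exists j b, [/\ admissible b, derivable b 0 1, b 0 != 0 &
      forall z, v z = z ^+ j * b z]) \/
    exists b, admissible b /\ forall z, v z = z ^+ k * b z.
  elim: k => [|k [?|[b [ab vb]]]].
  - by right; exists v; split=> // z; rewrite expr0 mul1r.
  - by left.
  - have db : derivable b 0 1.
      exact (removable_singularity ab (ex_intro _ (M * 2 ^+ k) (rem k b ab vb))).
    have [b0|b0] := eqVneq (b 0) 0; last by left; exists k, b.
    have [b' [ab' bb']] := divide_zero ab db b0.
    by right; exists b'; split=> // z; rewrite vb bb' exprSr mulrA.
have [K [d [d0 dh dP]]] := cauchy_estimate.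
(* Since [d <= 1/4], this gives [t <= 1/8], small enough to beat the growth [2 ^+ k] of the bounds
   on the contour. *)
pose t := d / 2.
have t0 : 0 < t by rewrite divr_gt0.
pose w := mkC t 0.
have wt : nm w = t by rewrite nm_real gtr0_norm.
have w0 : w != 0 by rewrite -nm_gt0 wt.
have wd : nm w < d by rewrite wt /t; lra.
have t8 : t <= 8^-1 by move: dh; rewrite /t /half; lra.
have [w1 w2] : `|re w| < 1 /\ `|im w| < 1.
  by apply: nm_small_in; apply: lt_le_trans dh.
have nv : 0 < nm (v w) by rewrite nm_gt0 v0.
(* With this [k], the estimate by [K * M / 4 ^+ k] and [k <= 4 ^+ k] contradict
   [K * M < k * nm (v w)]. *)
pose k := (Num.truncn (K * M / nm (v w))).+1.
have kP : K * M < k%:R * nm (v w) by rewrite -ltr_pdivrMr// truncnS_gt.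
have [//|[b [ab vb]]] := step k.
have bw := dP b (M * 2 ^+ k) w ab (rem _ _ ab vb) w0 wd.
have : nm (v w) * k%:R <= K * M.
  rewrite vb nmM nmX wt.
  have K0 : 0 <= K * (M * 2 ^+ k) by apply: le_trans bw; exact: nm_ge0.
  apply: le_trans (_ : (8^-1) ^+ k * (K * (M * 2 ^+ k)) * k%:R <= _).
    rewrite ler_wpM2r//; apply: ler_pM; rewrite ?exprn_ge0 ?nm_ge0//; first exact: ltW.
    by apply: lerXn2r; rewrite ?nnegrE// ltW.
  have KM : 0 <= K * M by move: K0; rewrite mulrA pmulr_lge0// exprn_gt0.
  have k4 : k%:R <= (4 : R) ^+ k.
    by rewrite -natrX ler_nat ltnW// ltn_expl.
  rewrite (_ : _ * _ = (8^-1 * 2) ^+ k * k%:R * (K * M)); last by rewrite exprMn; ring.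
  rewrite -[X in _ <= X]mul1r ler_wpM2r//.
  rewrite (_ : 8^-1 * 2 = 4^-1); last by field.
  by rewrite exprVn ler_pdivrMl ?exprn_gt0// mulr1.
by rewrite leNgt [nm _ * _]mulrC kP.
Qed.

End LocalFactorization.

(** * Factorization at an arbitrary point *)

Section LocalFactorizationAt.
Variable R : realType.
Local Notation C := (Cx R).
Implicit Types (u F G : C -> C) (w z : C).

(* Precomposing with the retraction onto the square [-1,1]^2 turns a function defined
   near a point into a globally continuous one. *)
Definition clampR (x : R) : R := if x < -1 then -1 else if 1 < x then 1 else x.
Definition clampC z : C := mkC (clampR (re z)) (clampR (im z)).

Lemma clampR_id (x : R) : `|x| < 1 -> clampR x = x.
Proof.
rewrite ltr_norml => /andP[h1 h2].
by rewrite /clampR !ltNge (ltW h1) (ltW h2).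
Qed.

Lemma clampR_le1 (x : R) : `|clampR x| <= 1.
Proof.
rewrite ler_norml /clampR; case: (ltP x (-1)) => h; last case: (ltP 1 x) => h';
  by apply/andP; split; lra.
Qed.

Lemma clampR_lip (x y : R) : `|clampR x - clampR y| <= `|x - y|.
Proof.
wlog xy : x y / x <= y.
  move=> H; case: (leP x y) => [|/ltW] /H //.
  by rewrite distrC [X in _ <= X]distrC.
rewrite distrC [X in _ <= X]distrC (ger0_norm (_ : 0 <= y - x)) ?subr_ge0//.
rewrite ler_norml /clampR.
case: (ltP x (-1)) => h1; case: (ltP y (-1)) => h2;
  case: (ltP 1 x) => h3; case: (ltP 1 y) => h4; by apply/andP; split; lra.
Qed.

Lemma clampC_id z : `|re z| < 1 -> `|im z| < 1 -> clampC z = z.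
Proof. by move=> h1 h2; apply: C_eq; rewrite /= clampR_id. Qed.

Lemma nm_clampC z : nm (clampC z) <= 2.
Proof.
apply: le_trans (nm_le_ReIm _) _; have := clampR_le1 (re z); have := clampR_le1 (im z).
by rewrite /=; lra.
Qed.

Lemma clampC_lip y z : nm (clampC y - clampC z) <= 2 * nm (y - z).
Proof.
apply: le_trans (nm_le_ReIm _) _; rewrite !CE /=.
have := clampR_lip (re y) (re z); have := clampR_lip (im y) (im z).
by have := Re_le_nm (y - z); have := Im_le_nm (y - z); rewrite !CE; lra.
Qed.

Lemma derC_comp_affine u (A B : C) z : derivable u (A + B * z) 1 ->
  derivable (fun y => u (A + B * y)) z 1.
Proof.
move=> /derivableC[D DP]; apply/derivableC; exists (D * B) => e e0.
have n0 := nm_ge0 B; have n1 : 0 < nm B + 1 by rewrite ltr_wpDl.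
(* Dividing by [nm B + 1] instead of [nm B] also covers [B = 0]. *)
have [d d0 dP] := DP _ (divr_gt0 e0 n1).
exists (d / (nm B + 1)); first exact: divr_gt0.
move=> y yd; have y0 := nm_ge0 (y - z).
have E : (A + B * y) - (A + B * z) = B * (y - z) by rewrite opprD addrACA subrr add0r mulrBr.
have small : nm (B * (y - z)) < d.
  move: yd; rewrite ltr_pdivlMr// => yd; apply: le_lt_trans yd.
  by rewrite nmM mulrC ler_wpM2l// lerDl.
have := dP (A + B * y); rewrite E => /(_ small) H.
rewrite -mulrA; apply: (le_trans H).
by rewrite nmM mulrA ler_wpM2r// mulrAC ler_pdivrMr// ler_pM2l// lerDl.
Qed.

(** An affine change of variable moves [z0] to the origin and a small square to the unit one;
    clamping then makes the function globally continuous and bounded. *)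
Lemma zero_factorization_at u z0 : {for z0, continuous u} ->
  (\forall z \near z0^', derivable u z 1) -> (\forall z \near z0^', u z != 0) ->
  exists k b, [/\ holo_near b z0, b z0 != 0 &
    \forall z \near z0^', u z = (z - z0) ^+ k * b z].
Proof.
move=> cu /dnearC[r1 r10 du] /dnearC[r2 r20 nu].
have [r3 r30 bu] := (contC _ _).1 cu _ ltr01.
pose r := Num.min r1 (Num.min r2 r3).
have r0 : 0 < r by rewrite !lt_min r10 r20 r30.
have rP x : x < r -> [/\ x < r1, x < r2 & x < r3].
  by rewrite !lt_min => /and3P[].
(* Clamped points have modulus at most 2, so their images stay within [r / 2] of [z0]. *)
pose rho := r / 4.
have rho0 : 0 < rho by rewrite divr_gt0.
pose B : C := mkC rho 0.
have nB : nm B = rho by rewrite nm_real gtr0_norm.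
have B0 : B != 0 by rewrite -nm_gt0 nB.
pose v z := u (z0 + B * clampC z).
have inr z : nm (z0 + B * clampC z - z0) < r.
  rewrite addrC addKr nmM nB.
  have := ler_wpM2l (ltW rho0) (nm_clampC z); rewrite /rho; lra.
have clr z : clampC z != 0 -> z0 + B * clampC z != z0.
  by move=> z1; rewrite -subr_eq0 addrC addKr mulf_neq0.
have cuz z : {for z0 + B * clampC z, continuous u}.
  have [->//|ne] := eqVneq (z0 + B * clampC z) z0.
  by apply: derivable_contC; apply: du => //; have [] := rP _ (inr z).
have cv : continuous v.
  move=> z; apply/contC => e e0.
  have [d d0 dP] := (contC _ _).1 (cuz z) e e0.
  exists (d / (2 * rho)); first by rewrite divr_gt0// mulr_gt0.
  move=> y; rewrite ltr_pdivlMr ?mulr_gt0// => yz; apply: dP.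
  rewrite opprD addrACA subrr add0r -mulrBr nmM nB.
  have := ler_wpM2l (ltW rho0) (clampC_lip y z); lra.
have dv z : `|re z| < 1 -> `|im z| < 1 -> z != 0 -> derivable v z 1.
  move=> z1 z2 zn; have clz := clampC_id z1 z2.
  have dz : derivable (fun y => u (z0 + B * y)) z 1.
    apply: derC_comp_affine; rewrite -clz; apply: du; last by have [] := rP _ (inr z).
    by apply: clr; rewrite clz.
  have e : \forall y \near z, u (z0 + B * y) = v y.
    apply/nearC; exists (Num.min (1 - `|re z|) (1 - `|im z|)).
      by rewrite lt_min !subr_gt0 z1.
    move=> y; rewrite lt_min => /andP[y1 y2]; rewrite /v clampC_id//.
      have := Re_le_nm (y - z); rewrite CE => h; have := ler_normD (re y - re z) (re z).
      by rewrite subrK !CE in h *; lra.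
    have := Im_le_nm (y - z); rewrite CE => h; have := ler_normD (im y - im z) (im z).
    by rewrite subrK !CE in h *; lra.
  exact (derC_ext e dz).
have bv z : nm (v z) <= nm (u z0) + 1.
  have [_ _ /bu h] := rP _ (inr z).
  have := nmD (v z - u z0) (u z0); rewrite subrK; move: h; rewrite -/(v z); lra.
have nv z : `|re z| < 1 -> `|im z| < 1 -> z != 0 -> v z != 0.
  move=> z1 z2 zn; have clz := clampC_id z1 z2; apply: nu.
    by apply: clr; rewrite clz.
  by have [] := rP _ (inr z).
have [k [b [[cb db] db0 b0 vb]]] := zero_factorization (conj cv dv) bv nv.
(* The inverse change of variable, written in the shape [A + B * z] expected by
   [derC_comp_affine]. *)
pose y z := - (B^-1 * z0) + B^-1 * z.
have yE z : y z = B^-1 * (z - z0) by rewrite /y mulrBr addrC.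
have yS z : nm (z - z0) < rho -> `|re (y z)| < 1 /\ `|im (y z)| < 1.
  move=> h; have h1 : nm (y z) < 1.
    by rewrite yE nmM nmV nB ltr_pdivrMl// mulr1.
  by split; apply: le_lt_trans h1; [exact: Re_le_nm|exact: Im_le_nm].
exists k, (fun z => B^-1 ^+ k * b (y z)); split.
- apply/nearC; exists rho; first exact: rho0.
  move=> z /yS[z1 z2].
  apply: derC_mul; first exact: derC_cst.
  apply: derC_comp_affine; rewrite -/(y z).
  by have [->|yn] := eqVneq (y z) 0; [exact: db0|exact: db].
- by rewrite yE subrr mulr0 mulf_neq0// expf_neq0// invr_eq0.
- apply/dnearC; exists rho; first exact: rho0.
  move=> z _ /yS[z1 z2].
  have -> : u z = v (y z).
    by rewrite /v clampC_id// yE mulrA divff// mul1r subrKC.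
  by rewrite vb mulrA; congr (_ * _); rewrite yE exprMn mulrC.
Qed.

End LocalFactorizationAt.

(** * Shared values *)

Section SharedValues.
Variable R : realType.
Local Notation C := (Cx R).
Implicit Types (F G h b u : C -> C) (f g alpha phi : C -> option C) (D : set C).

Lemma holo_near_at F z0 : holo_near F z0 -> derivable F z0 1.
Proof. by move=> /nearC[d d0]; apply; rewrite subrr nm0. Qed.

Lemma holo_near_mul F G z0 : holo_near F z0 -> holo_near G z0 ->
  holo_near (fun z => F z * G z) z0.
Proof.
move=> /nearC[d d0 dF] /nearC[e e0 dG]; apply/nearC; exists (Num.min d e).
  by rewrite lt_min d0.
move=> z; rewrite lt_min => /andP[zd ze].
exact (derC_mul (dF z zd) (dG z ze)).
Qed.

Lemma holo_near_add F G z0 : holo_near F z0 -> holo_near G z0 ->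
  holo_near (fun z => F z + G z) z0.
Proof.
move=> /nearC[d d0 dF] /nearC[e e0 dG]; apply/nearC; exists (Num.min d e).
  by rewrite lt_min d0.
move=> z; rewrite lt_min => /andP[zd ze].
exact (derC_add (dF z zd) (dG z ze)).
Qed.

Lemma holo_near_neq0 F z0 : holo_near F z0 -> F z0 != 0 -> \forall z \near z0, F z != 0.
Proof.
move=> /holo_near_at/derivable_contC/contC cF; rewrite -nm_gt0 => /cF[d d0 dP].
apply/nearC; exists d => // z /dP; apply: contraTneq => ->.
by rewrite sub0r nmN ltxx.
Qed.

Lemma holo_near_inv F z0 : holo_near F z0 -> F z0 != 0 ->
  holo_near (fun z => (F z)^-1) z0.
Proof.
move=> dF F0; have /nearC[e e0 nF] := holo_near_neq0 dF F0.
move: dF => /nearC[d d0 dF]; apply/nearC; exists (Num.min d e).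
  by rewrite lt_min d0.
move=> z; rewrite lt_min => /andP[zd ze].
exact (derC_inv (nF z ze) (dF z zd)).
Qed.

Lemma holo_near_cst (k : C) z0 : holo_near (fun=> k) z0.
Proof. by apply/nearC; exists 1; [exact: ltr01|move=> z _; exact: derC_cst]. Qed.

Lemma holo_near_pow (z0 : C) m : holo_near (fun z : C => (z - z0) ^+ m) z0.
Proof.
apply/nearC; exists 1; first exact: ltr01.
by move=> z _; apply: derC_exp; apply: derC_sub; [exact: derC_id|exact: derC_cst].
Qed.

Arguments holo_near_mul {F G z0} _ _.
Arguments holo_near_add {F G z0} _ _.
Arguments holo_near_inv {F z0} _ _.
Arguments holo_near_cst k z0.
Arguments holo_near_pow z0 m.

(** The operations return [None] at infinite arguments and zero denominators, so a finite value of
    [f / alpha - 1] makes [f] and [alpha] finite and [alpha] nonzero. *)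
Lemma zero_of_quotientE f alpha z0 m :
  zero_of_order (osub (odiv f alpha) (ocst 1)) z0 m ->
  exists h, [/\ holo_near h z0, h z0 != 0 & \forall z \near z0^',
    exists a, [/\ alpha z = Some a, a != 0 & f z = Some (a * (1 + (z - z0) ^+ m * h z))]].
Proof.
move=> [h [dh h0 /dnearC[d d0 H]]]; exists h; split => //.
apply/dnearC; exists d => // z zz zd; have := H z zz zd.
rewrite /osub /odiv /ocst; case: (f z) => [c|//]; case: (alpha z) => [a|//].
case: eqVneq => // a0 [E]; exists a; split=> //; congr Some.
by rewrite -E addrC subrK mulrC divfK.
Qed.

(** One implication is enough, because sharing is symmetric in [f] and [g]. *)
Lemma share_transfer D f g alpha z0 m : open D -> D z0 -> meromorphic_on D alpha ->
  share_CM_value D f g alpha -> (0 < m)%N ->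
  zero_of_order (osub (odiv f alpha) (ocst 1)) z0 m ->
  zero_of_order (osub (odiv g alpha) (ocst 1)) z0 m.
Proof.
move=> oD Dz0 [_ mer2 mer3] share m0 /zero_of_quotientE[h [dh h0 /dnearC[r r0 H]]].
have [share1 share2] := share _ Dz0.
have /nearC[rD rD0 DP] := open_nbhs_nbhs (conj oD Dz0).
pose s := Num.min r rD.
have s0 : 0 < s by rewrite lt_min r0.
have sP x : x < s -> x < r /\ x < rD by rewrite lt_min => /andP.
clearbody s.
have dalpha z : z != z0 -> nm (z - z0) < s -> derivable (oval alpha) z 1.
  move=> zz zs; have [z1 z2] := sP _ zs; apply: mer2; first exact: DP.
  by have [a [-> _ _]] := H z zz z1.
have noval z : z != z0 -> nm (z - z0) < s -> oval alpha z != 0.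
  move=> zz /sP[z1 _]; have [a [E a0 _]] := H z zz z1.
  by rewrite /oval E.
have E1 z : z != z0 -> nm (z - z0) < s -> alpha z = Some (oval alpha z) /\
    f z = Some (oval alpha z * (1 + (z - z0) ^+ m * h z)).
  move=> zz /sP[z1 _]; have [a [E a0 Ef]] := H z zz z1.
  by rewrite /oval E.
case Ea : (alpha z0) => [a0|].
  have az0 : alpha z0 != None by rewrite Ea.
  have [k [b [db b0 /dnearC[t t0 ub]]]] : exists k b, [/\ holo_near b z0, b z0 != 0 &
      \forall z \near z0^', oval alpha z = (z - z0) ^+ k * b z].
    apply: zero_factorization_at.
    - by apply: derivable_contC; exact: mer2.
    - by apply/dnearC; exists s.
    - by apply/dnearC; exists s.
  (* Here [f - alpha = alpha * (z - z0) ^+ m * h], and [alpha] contributes the factor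
     [(z - z0) ^+ k * b]. *)
  have zf : zero_of_order (osub f alpha) z0 (m + k).
    exists (fun z => b z * h z); split; [exact (holo_near_mul db dh)|by rewrite mulf_neq0|].
    apply/dnearC; exists (Num.min s t); first by rewrite lt_min s0.
    move=> z zz; rewrite lt_min => /andP[zs zt].
    have [e1 e2] := E1 z zz zs; rewrite /osub e1 e2; congr Some.
    by rewrite (ub z zz zt) exprD; ring.
  have mk : (0 < m + k)%N by rewrite addn_gt0 m0.
  have [h' [dh' h'0 /dnearC[t' t'0 H']]] := (share1 az0 _ mk).1 zf.
  (* Dividing [g - alpha = (z - z0) ^+ (m + k) * h'] by [alpha] cancels [(z - z0) ^+ k] and leaves
     [h' / b]. *)
  exists (fun z => h' z * (b z)^-1); split.
  - exact (holo_near_mul dh' (holo_near_inv db b0)).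
  - by rewrite mulf_neq0// invr_eq0.
  apply/dnearC; exists (Num.min s (Num.min t t')).
    by rewrite !lt_min s0 t0.
  move=> z zz; rewrite !lt_min => /and3P[zs zt zt'].
  have [e1 _] := E1 z zz zs; have nu := noval z zz zs.
  have := H' z zz zt'; rewrite /osub /odiv /ocst e1.
  case: (g z) => [c|//] [E]; rewrite (negbTE nu); congr Some.
  have -> : c = (z - z0) ^+ (m + k) * h' z + oval alpha z by rewrite -E subrK.
  have bz := ub z zz zt; move: nu; rewrite bz mulf_eq0 negb_or => /andP[nz nb].
  by rewrite exprD; field; rewrite nz nb.
pose u z := (oval alpha z)^-1.
(* Both [oval] at a pole and the inverse of 0 default to 0, which is exactly the limit of [1/alpha];
   hence [u] is continuous at [z0]. *)
have uz0 : u z0 = 0 by rewrite /u /oval Ea invr0.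
have cu : {for z0, continuous u}.
  by apply/continuous_withinNx; rewrite uz0; exact: mer3.
have [k [b [db b0 /dnearC[t t0 ub]]]] : exists k b, [/\ holo_near b z0, b z0 != 0 &
    \forall z \near z0^', u z = (z - z0) ^+ k * b z].
  apply: zero_factorization_at; first exact: cu.
  - apply/dnearC; exists s; first exact: s0.
    by move=> z zz zs; exact (derC_inv (noval z zz zs) (dalpha z zz zs)).
  - apply/dnearC; exists s; first exact: s0.
    by move=> z zz zs; rewrite invr_eq0; exact: noval.
have mk : (0 < m + k)%N by rewrite addn_gt0 m0.
have hs F : holo_near F z0 -> holo_near (fun z => (z - z0) ^+ m * F z) z0.
  by move=> dF; exact (holo_near_mul (holo_near_pow z0 m) dF).
have d1 : holo_near (fun z => 1 + (z - z0) ^+ m * h z) z0.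
  exact (holo_near_add (holo_near_cst 1 z0) (hs _ dh)).
have z0m (F : C -> C) : (z0 - z0) ^+ m * F z0 = 0 by rewrite subrr expr0n gtn_eqF// mul0r.
have n1 : 1 + (z0 - z0) ^+ m * h z0 != 0 by rewrite z0m addr0 oner_eq0.
have zf : zero_of_order (osub (Defs.oinv f) (Defs.oinv alpha)) z0 (m + k).
  (* With [p = (z - z0) ^+ m * h], the difference is [u / (1 + p) - u = - u * p / (1 + p)]. *)
  exists (fun z => (-1 * (b z * h z)) * (1 + (z - z0) ^+ m * h z)^-1); split.
  - exact (holo_near_mul (holo_near_mul (holo_near_cst (-1) z0) (holo_near_mul db dh))
      (holo_near_inv d1 n1)).
  - by rewrite !mulf_neq0 ?invr_eq0 ?oppr_eq0 ?oner_eq0.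
  have /nearC[t1 t10 nn] := holo_near_neq0 d1 n1.
  apply/dnearC; exists (Num.min s (Num.min t t1)); first by rewrite !lt_min s0 t0.
  move=> z zz; rewrite !lt_min => /and3P[zs zt zt1].
  have [e1 e2] := E1 z zz zs; have nu := noval z zz zs; have nz := nn z zt1.
  rewrite /osub /Defs.oinv e1 e2 mulf_eq0 (negbTE nu) (negbTE nz) /=; congr Some.
  have bz := ub z zz zt; rewrite invfM -/(u z) bz exprD.
  by field.
have [h' [dh' h'0 /dnearC[t' t'0 H']]] := (share2 Ea _ mk).1 zf.
have d2 : holo_near (fun z => b z + (z - z0) ^+ m * h' z) z0.
  exact (holo_near_add db (hs _ dh')).
have n2 : b z0 + (z0 - z0) ^+ m * h' z0 != 0 by rewrite z0m addr0.
(* From [1/g = (z - z0) ^+ k * (b + (z - z0) ^+ m * h')] follows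
   [g / alpha = b / (b + (z - z0) ^+ m * h')]; subtracting 1 gives the witness. *)
exists (fun z => (-1 * h' z) * (b z + (z - z0) ^+ m * h' z)^-1); split.
- exact (holo_near_mul (holo_near_mul (holo_near_cst (-1) z0) dh') (holo_near_inv d2 n2)).
- by rewrite !mulf_neq0 ?invr_eq0 ?oppr_eq0 ?oner_eq0.
have /nearC[t1 t10 nn] := holo_near_neq0 d2 n2.
apply/dnearC; exists (Num.min (Num.min s t) (Num.min t1 t')).
  by rewrite !lt_min s0 t0 t10.
move=> z zz; rewrite !lt_min => /andP[/andP[zs zt] /andP[zt1 zt']].
have [e1 _] := E1 z zz zs; have nu := noval z zz zs; have nz := nn z zt1.
have bz := ub z zz zt.
have zk : (z - z0) ^+ k != 0 by rewrite expf_neq0// subr_eq0.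
have inv_g c : c - u z = (z - z0) ^+ (m + k) * h' z ->
    c = (z - z0) ^+ k * (b z + (z - z0) ^+ m * h' z).
  by move=> E; rewrite -[c](subrK (u z)) E bz exprD; ring.
have := H' z zz zt'; rewrite /osub /odiv /Defs.oinv /ocst e1 (negbTE nu) -/(u z).
(* A pole of [g] would give [1/g] the value 0, against its nonvanishing factorization; a zero of [g]
   would make [1/g] infinite. *)
case: (g z) => [c|]; last first.
  move=> [/inv_g/esym/eqP]; by rewrite mulf_eq0 (negbTE zk) (negbTE nz).
case: eqVneq => // c0 [/inv_g E]; congr Some.
rewrite -/(u z) -[c]invrK E bz.
by field; rewrite zk nz.
Qed.

End SharedValues.

Lemma share_CM_value_sym (R : realType) (D : set (Cx R)) f g alpha :
  share_CM_value D f g alpha -> share_CM_value D g f alpha.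
Proof.
by move=> H z0 /H[h1 h2]; split=> [a m m0|a m m0]; apply: iff_sym; [exact: h1|exact: h2].
Qed.

Unset Implicit Arguments.
Set Strict Implicit.

Theorem theorem2 (R : realType) (D : set (Cx R)) (f g alpha : Cx R -> option (Cx R)) :
  domain D ->
  meromorphic_on D f -> meromorphic_on D g -> meromorphic_on D alpha ->
  ~ (forall z, D z -> alpha z = Some 0) ->
  ~ (forall z, D z -> alpha z = None) ->
  share_CM_value D f g alpha ->
  forall z0, D z0 -> forall m : nat, (0 < m)%N ->
    zero_of_order (osub (odiv f alpha) (ocst 1)) z0 m <->
    zero_of_order (osub (odiv g alpha) (ocst 1)) z0 m.
Proof.
move=> [oD _] _ _ mer _ _ share z0 Dz0 m m0.
split; first exact: share_transfer oD Dz0 mer share m0.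
exact: share_transfer oD Dz0 mer (share_CM_value_sym share) m0.
Qed.
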